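(* Let $d\ge 1$ and let $\mathbf{a}:\mathbb{R}\times\mathbb{R}\times\mathbb{R}^d\to\mathbb{R}^d$, $(t,\theta,\mathbf{x})\mapsto\mathbf{a}(t,\theta,\mathbf{x})$, and $\mathbf{b}:\mathbb{R}\times\mathbb{R}^d\to\mathbb{R}^d$, $(t,\mathbf{x})\mapsto\mathbf{b}(t,\mathbf{x})$, satisfy: $\mathbf{a}\in (C_b^{1}(\mathbb{R}\times\mathbb{R}\times\mathbb{R}^d))^d$; $\theta\mapsto\mathbf{a}(t,\theta,\mathbf{x})$ is $2\pi$-periodic for every $t\in\mathbb{R}$, $\mathbf{x}\in\mathbb{R}^d$; and $\mathbf{b}\in(C_b^{2}(\mathbb{R}\times\mathbb{R}^d))^d$. Suppose that the solution $\mathbf{Z}(t,\theta;\mathbf{z})$ of $$\frac{\partial\mathbf{Z}}{\partial\theta}=\mathbf{b}(t,\mathbf{Z}),\qquad \mathbf{Z}(t,0;\mathbf{z})=\mathbf{z},$$ is $2\pi$-periodic in $\theta$ for every $t\in\mathbb{R}$ and $\mathbf{z}\in\mathbb{R}^d$. Set $$\tilde\alpha^0(t,\theta,\mathbf{y})=\{\nabla_z\mathbf{Z}(t,\theta;\mathbf{y})\}^{-1}\Big\{\mathbf{a}(t,\theta,\mathbf{Z}(t,\theta;\mathbf{y}))-\frac{\partial\mathbf{Z}}{\partial t}(t,\theta;\mathbf{y})\Big\},\qquad \tilde{\mathbf{a}}^0(t,\mathbf{y})=\frac1{2\pi}\int_0^{2\pi}\tilde\alpha^0(t,\theta,\mathbf{y})\,d\theta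 .$$ Then for any $\mathbf{x}\in\mathbb{R}^d$, $s\in\mathbb{R}$, $T>0$ and any $\varepsilon>0$, the solution $\mathbf{X}_\varepsilon(\cdot;\mathbf{x},s)$ of $$\frac{d\mathbf{X}_\varepsilon}{dt}=\mathbf{a}\Big(t,\frac{t-s}{\varepsilon},\mathbf{X}_\varepsilon\Big)+\frac1\varepsilon\mathbf{b}(t,\mathbf{X}_\varepsilon),\qquad \mathbf{X}_\varepsilon(s;\mathbf{x},s)=\mathbf{x},$$ exists on $[s,s+T]$ and is unique, and $$\lim_{\varepsilon\to0}\ \sup_{t\in[s,s+T]}\Big|\mathbf{X}_\varepsilon(t;\mathbf{x},s)-\mathbf{X}^0\Big(t,\frac{t-s}{\varepsilon};\mathbf{x},s\Big)\Big|=0,$$ where $\mathbf{X}^0(t,\theta;\mathbf{x},s)=\mathbf{Z}(t,\theta;\mathbf{Y}^0(t;\mathbf{x},s))$ and $\mathbf{Y}^0$ is the solution of $$\frac{d\mathbf{Y}^0}{dt}=\tilde{\mathbf{a}}^0(t,\mathbf{Y}^0),\qquad \mathbf{Y}^0(s;\mathbf{x},s)=\mathbf{x}.$$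
   Context: $C_b^{m}$ denotes the space of functions having continuous and bounded derivatives up to order $m$ (order $0$, i.e. the function itself, included). $|\cdot|$ is the Euclidean norm on $\mathbb{R}^d$. $\nabla_z\mathbf{Z}(t,\theta;\mathbf{z})$ is the Jacobian matrix of $\mathbf{z}\mapsto\mathbf{Z}(t,\theta;\mathbf{z})$. *)

(* Defs.v *)
(* MathComp-Analysis, over an arbitrary R : realType.  R^d is 'rV[R]_d. *)
From HB Require Import structures.
From mathcomp Require Import all_boot all_order all_algebra.
From mathcomp Require Import all_classical all_reals all_analysis.

Set Implicit Arguments.
Unset Strict Implicit.
Unset Printing Implicit Defensive.
Import Order.TTheory GRing.Theory Num.Theory.
Import numFieldNormedType.Exports.
Local Open Scope classical_set_scope.
Local Open Scope ring_scope.

(* The library norm `|x| on 'rV[R]_d is the max norm. *)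
Definition enorm (R : realType) (d : nat) (x : 'rV[R]_d) : R :=
  Num.sqrt (\sum_(i < d) x 0 i ^+ 2).

(* Derivatives are taken in every fixed direction v; since they are required to
   be continuous, 'D_v f is linear in v, so this is the same as asking for the
   partial derivatives along a basis of V. *)
Fixpoint Cb (R : realType) (V : normedModType R) (m : nat) (f : V -> R)
    : Prop :=
  [/\ continuous f, bounded_fun f &
      if m is k.+1 then
        forall v : V, (forall x, derivable f x v) /\ Cb k ('D_v f)
      else True].

Section ODE.
Variables (R : realType) (d : nat).
Implicit Types (F : R -> 'rV[R]_d -> 'rV[R]_d) (X : R -> 'rV[R]_d).

(* The derivative is relative to [u, v], i.e. one-sided at u and at v; values of
   X outside [u, v] are irrelevant. *)
Definition ivp_sol F (u v : R) (x : 'rV[R]_d) X : Prop :=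
  X u = x /\
  forall t, t \in `[u, v] ->
    (r - t)^-1 *: (X r - X t) @[r --> within `[u, v] t^'] --> F t (X t).

Definition ivp_well_posed F (u v : R) (x : 'rV[R]_d) : Prop :=
  exists2 X, ivp_sol F u v x X &
    forall X', ivp_sol F u v x X' -> {in `[u, v], X' =1 X}.

End ODE.

Section Averaging.
Variables (R : realType) (d : nat).
Implicit Types (a : R -> R -> 'rV[R]_d -> 'rV[R]_d).
Implicit Types (b : R -> 'rV[R]_d -> 'rV[R]_d).
Implicit Types (Z : R -> R -> 'rV[R]_d -> 'rV[R]_d).

Definition is_flow b Z : Prop :=
  forall t z, Z t 0 z = z /\
    forall theta : R, is_derive theta 1 (fun th => Z t th z) (b t (Z t theta z)).

(* Vectors are rows, and jacobian f y acts on them on the right: it is the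
   transpose of the usual Jacobian matrix, hence the product on the right by
   its inverse. *)
Definition alpha0 a Z (t theta : R) (y : 'rV[R]_d) : 'rV[R]_d :=
  (a t theta (Z t theta y) - derive1 (fun r => Z r theta y) t)
    *m invmx (jacobian (Z t theta) y).

Definition abar0 a Z (t : R) (y : 'rV[R]_d) : 'rV[R]_d :=
  \row_i ((2 * pi)^-1 *
    Rintegral (@lebesgue_measure R) `[0, 2 * pi]
      (fun theta => alpha0 a Z t theta y 0 i)).

Definition osc_field a b (s eps t : R) (x : 'rV[R]_d) : 'rV[R]_d :=
  a t ((t - s) / eps) x + eps^-1 *: b t x.

End Averaging.

(* Main.v *)
(* Let mu(theta, p, v) solve the variational equation of the flow Z along the
   orbit of p = (t, z) in the direction v = (tau, h).  It is the differential of
   (t, z) |-> Z t theta z, and the cocycle property gives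
     alpha0 t theta y = mu(- theta, (t, Z t theta y), (1, a t theta (Z t theta y))),
   so that no inverse matrix has to be estimated: alpha0 is bounded, Lipschitz in
   (t, y) and periodic in theta.  The filtered solution
   Y t = Z t (- (t - s) / eps) (X_eps t) solves Y' = alpha0 t ((t - s) / eps) Y,
   and its mean over a sliding window of length 2 pi eps solves the averaged
   equation up to O(eps); Gronwall's lemma concludes. *)

Require Import Defs.
From HB Require Import structures.
From mathcomp Require Import all_boot all_order all_algebra.
From mathcomp Require Import all_classical all_reals all_analysis.
From mathcomp Require Import ring lra.

Set Implicit Arguments.
Unset Strict Implicit.
Unset Printing Implicit Defensive.
Import Order.TTheory GRing.Theory Num.Theory.
Import numFieldNormedType.Exports.
Local Open Scope classical_set_scope.
Local Open Scope ring_scope.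

(** * Calculus for curves of row vectors *)

Section RowVectors.
Variables (R : realType) (d : nat).
Implicit Types (x y : 'rV[R]_d) (u du : R -> 'rV[R]_d) (t p q : R).

(** The fast angle (t - s) / eps is unbounded as eps tends to 0, while Gronwall's lemma loses an
    exponential in the length of the interval. Reducing the angle to one period is what makes the
    Lipschitz constant of the flow and the bounds on alpha0 independent of eps. No regularity of Z
    in (t, z) is assumed: its differentiability is proved. The candidate mu comes from Picard's
    theorem for the linear variational equation, and Gronwall's lemma bounds the remainder of Z by
    the square of the increment. The second derivatives of b enter through the Lipschitz dependence
    of [Db] on the base point, which passes to mu and then to alpha0. Solutions are built on the
    whole line and identified with the given ones on [s, s + T] by uniqueness, so that the averaging
    window may reach beyond s + T. Means are handled as increments of primitives, for which a mean
    value inequality in the max norm suffices; the Euclidean norm returns at the end, at the cost of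
    a factor sqrt d. *)

Lemma norm_coord_le x i : `|x 0 i| <= `|x|.
Proof.
rewrite [leRHS]/Num.Def.normr/= mx_normrE.
by apply: le_trans; last exact: (le_bigmax _ _ (0, i)).
Qed.

Lemma norm_row_le x (c : R) : 0 <= c -> (forall i, `|x 0 i| <= c) -> `|x| <= c.
Proof.
move=> c0 xc; rewrite [leLHS]/Num.Def.normr/= mx_normrE.
by apply: bigmax_le => // -[i j] _ /=; rewrite (ord1 i).
Qed.

Lemma is_derive_rowP (V : normedModType R) (M : V -> 'rV[R]_d) (t v : V)
    (l : 'rV[R]_d) :
  is_derive t v M l <-> forall i, is_derive t v (fun r => M r 0 i) (l 0 i).
Proof.
split=> [[dM <-] i|dM].
  split; first by move/derivable_mxP : dM.
  by rewrite derive_mx// mxE.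
have dM' : derivable M t v.
  by apply/derivable_mxP => i j; rewrite (ord1 i); have [] := dM j.
split => //; rewrite derive_mx//; apply/rowP => i; rewrite mxE.
by have [] := dM i.
Qed.

Lemma is_derive_coord u t (l : 'rV[R]_d) i :
  is_derive t 1 u l -> is_derive t 1 (fun r => u r 0 i) (l 0 i).
Proof. by move/is_derive_rowP. Qed.

End RowVectors.

Section Increments.
Variable R : realType.

Lemma is_derive_continuous (V : normedModType R) (u : R -> V) (t : R) (l : V) :
  is_derive t 1 u l -> {for t, continuous u}.
Proof.
by move=> [du _]; apply: differentiable_continuous; apply/derivable1_diffP.
Qed.

Lemma is_derive_continuousT (V : normedModType R) (u du : R -> V) :
  (forall t : R, is_derive t 1 u (du t)) -> continuous u.
Proof. by move=> du' t; exact: is_derive_continuous (du' t). Qed.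

Lemma is_derive_within (V : normedModType R) (u du : R -> V) (A : set R) :
  (forall t : R, is_derive t 1 u (du t)) -> {within A, continuous u}.
Proof. by move=> H; apply: continuous_subspaceT; exact: is_derive_continuousT H. Qed.

Lemma nincr_within (f df : R -> R) (p q : R) : p <= q ->
  {within `[p, q], continuous f} ->
  (forall t : R, t \in `]p, q[ -> is_derive t 1 f (df t)) ->
  (forall t : R, t \in `]p, q[ -> df t <= 0) -> f q <= f p.
Proof.
(* The minimum with 0 merges two cases: for p < q the mean value point is interior and [df c <= 0],
   while for p = q nothing is known of [df c] and both sides vanish. *)
move=> pq cf Hf Hdf; have [c cpq E] : exists2 c, c \in `[p, q]%R &
    f q - f p = Num.min (df c) 0 * (q - p).
  move: pq; rewrite le_eqVlt => /predU1P[<-|pq].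
    by exists p; rewrite ?in_itv/= ?lexx// !subrr mulr0.
  have [c cpq E] := MVT pq Hf cf; exists c.
    by rewrite in_itv/= !ltW// (itvP cpq).
  by rewrite E min_l// Hdf.
rewrite -subr_le0 E mulr_le0_ge0 ?subr_ge0//.
by rewrite ge_min lexx orbT.
Qed.

(** In the max norm it suffices to treat coordinates: [g + u_i] and [g - u_i] have nonnegative
    derivatives. This inequality stands in for integral estimates in the rest of the proof. *)
Lemma norm_incr_le (d : nat) (u du : R -> 'rV[R]_d) (g dg : R -> R) (p q : R) :
  p <= q -> (forall t : R, is_derive t 1 u (du t)) ->
  (forall t : R, is_derive t 1 g (dg t)) ->
  (forall t : R, p <= t <= q -> `|du t| <= dg t) ->
  `|u q - u p| <= g q - g p.
Proof.
move=> pq Hu Hg Hle.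
have tpq t : t \in `]p, q[ -> p <= t <= q.
  by move=> tpq; rewrite !ltW// (itvP tpq).
have gi : 0 <= g q - g p.
  rewrite subr_ge0 -lerN2.
  apply: (@nincr_within (fun t => - g t) (fun t => - dg t)) => //.
    by apply: (is_derive_within (du := fun t => - dg t)) => t; exact: is_deriveN.
  by move=> t /tpq /Hle H; rewrite oppr_le0 (le_trans _ H).
apply: norm_row_le => // i; rewrite !mxE.
have Hui t := is_derive_coord i (Hu t).
have Hdu t : p <= t <= q -> `|du t 0 i| <= dg t.
  by move=> /Hle; apply: le_trans; exact: norm_coord_le.
rewrite ler_norml; apply/andP; split.
  suff : - (u q 0 i + g q) <= - (u p 0 i + g p) by lra.
  pose h t := - (u t 0 i + g t); pose dh t := - (du t 0 i + dg t).
  have Hh (t : R) : is_derive t 1 h (dh t) by apply: is_deriveN; apply: is_deriveD.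
  apply: (@nincr_within h dh) => //; first exact: is_derive_within Hh.
  by move=> t /tpq /Hdu; rewrite ler_norml /dh => /andP[]; lra.
suff : u q 0 i - g q <= u p 0 i - g p by lra.
pose h t := u t 0 i - g t; pose dh t := du t 0 i - dg t.
have Hh (t : R) : is_derive t 1 h (dh t) by apply: is_deriveB.
apply: (@nincr_within h dh) => //; first exact: is_derive_within Hh.
by move=> t /tpq /Hdu; rewrite ler_norml /dh => /andP[]; lra.
Qed.

(** The endpoints are unordered because flow times of both signs occur. *)
Lemma norm_incr_lin (d : nat) (u du : R -> 'rV[R]_d) (K p q : R) :
  (forall t : R, is_derive t 1 u (du t)) ->
  (forall t : R, Num.min p q <= t <= Num.max p q -> `|du t| <= K) ->
  `|u q - u p| <= K * `|q - p|.
Proof.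
move=> Hu.
wlog pq : p q / p <= q => [H|].
  have [pq|/ltW qp] := leP p q => HK.
    by apply: H => // t; rewrite min_l// max_r//; exact: HK.
  rewrite distrC [`|q - p|]distrC.
  by apply: H => // t; rewrite min_l// max_r//; exact: HK.
rewrite min_l// max_r// => HK; rewrite (ger0_norm (_ : 0 <= q - p)) ?subr_ge0// mulrBr.
apply: (@norm_incr_le d u du (fun t => K * t) (fun=> K * 1)) => // t.
by move=> /HK; rewrite mulr1.
Qed.

End Increments.

Section Enorm.
Variables (R : realType) (d : nat).
Implicit Types x : 'rV[R]_d.

Lemma norm_le_enorm x : `|x| <= enorm x.
Proof.
apply: norm_row_le => [|i]; first exact: sqrtr_ge0.
rewrite -sqrtr_sqr ler_sqrt; last by apply: sumr_ge0 => j _; exact: sqr_ge0.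
by rewrite (bigD1 i)//= lerDl; apply: sumr_ge0 => j _; exact: sqr_ge0.
Qed.

Lemma sum_sqr_le x : \sum_(i < d) x 0 i ^+ 2 <= d%:R * `|x| ^+ 2.
Proof.
rewrite mulr_natl -[X in _ *+ X](card_ord d) -sumr_const; apply: ler_sum => i _.
by rewrite -[leLHS]real_normK ?num_real// ler_pXn2r ?nnegrE ?norm_coord_le.
Qed.

Lemma enorm_le x : enorm x <= Num.sqrt d%:R * `|x|.
Proof.
rewrite -(ger0_norm (normr_ge0 x)) -sqrtr_sqr -sqrtrM ?ler0n//.
by rewrite ler_sqrt ?sum_sqr_le// mulr_ge0 ?ler0n ?sqr_ge0.
Qed.

End Enorm.

(** * Gronwall inequalities for vector curves *)

Section Gronwall.
Variable R : realType.

Lemma is_derive_affine (c e t : R) : is_derive t 1 (fun r : R => c * r + e) c.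
Proof.
have -> : (fun r : R => c * r + e) = (c \*: (@id R)) + cst e by [].
by apply: is_derive_eq; rewrite addr0 scaler1.
Qed.

(* The sum f of the squares of the coordinates of u satisfies f' <= K f + c, so
   that f exp (- K (t - p)) - c t is nonincreasing. *)
Lemma gronwall_within (d : nat) (L tau : R) : 0 <= L -> 0 <= tau ->
  exists2 G, 0 <= G & forall (u du : R -> 'rV[R]_d) (p q C : R),
    p <= q -> q - p <= tau -> 0 <= C -> {within `[p, q], continuous u} ->
    (forall t : R, t \in `]p, q[ -> is_derive t 1 u (du t)) ->
    (forall t : R, t \in `]p, q[ -> `|du t| <= L * `|u t| + C) ->
    `|u q| <= G * (`|u p| + C).
Proof.
move=> L0 tau0; pose K := d%:R * (2 * L + 1).
have K0 : 0 <= K by rewrite mulr_ge0 ?ler0n//; lra.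
(* From [f p <= d |u p|^2] and [c tau = d C^2 tau], with growth [exp (K tau)], comes
   [|u q|^2 <= f q <= G^2 (|u p| + C)^2]. The factor d in [K] counts the summands of f', each at
   most [(2 L + 1) |u|^2 + C^2]. *)
exists (Num.sqrt (expR (K * tau) * (d%:R * (1 + tau)))); first exact: sqrtr_ge0.
move=> u du p q C pq qp C0 cu Hu Hdu.
pose f := \sum_(i < d) (fun t : R => u t 0 i) ^+ 2.
have fE t : f t = \sum_(i < d) u t 0 i ^+ 2 by rewrite /f fct_sumE.
pose c := d%:R * C ^+ 2.
have c0 : 0 <= c by rewrite mulr_ge0 ?ler0n ?sqr_ge0.
pose E t : R := expR (- (K * (t - p))).
have HE (t : R) : is_derive t 1 E (- K * E t).
  have -> : E = expR \o (fun r => - K * r + K * p).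
    by apply/funext => r /=; rewrite /E; congr expR; ring.
  have -> : - K * (expR \o (fun r => - K * r + K * p)) t =
      expR (- K * t + K * p) * - K by rewrite mulrC.
  by apply: is_derive1_comp; exact: is_derive_affine.
pose df t := \sum_(i < d) (2 * u t 0 i * du t 0 i).
have Hf (t : R) : t \in `]p, q[ -> is_derive t 1 f (df t).
  move=> tpq; apply: is_derive_eq.
    by apply: is_derive_sum => i; apply: is_deriveX; apply: is_derive_coord (Hu _ tpq).
  by apply: eq_bigr => i _; rewrite expr1.
pose h := f * E - (fun r : R => c * r + 0).
have Hh (t : R) : t \in `]p, q[ -> is_derive t 1 h
    (f t *: (- K * E t) + E t *: df t - c).
  move=> tpq; apply: is_deriveB; last exact: is_derive_affine.
  by apply: is_deriveM => //; exact: Hf.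
have dhle (t : R) : t \in `]p, q[ ->
    f t *: (- K * E t) + E t *: df t - c <= 0.
  move=> tpq; rewrite /GRing.scale/=.
  have Et1 : E t <= 1.
    by rewrite expR_le1 oppr_le0 mulr_ge0// subr_ge0 ltW// (itvP tpq).
  have Et0 : 0 <= E t := expR_ge0 _.
  have dfle : df t <= K * f t + c.
    have : df t <= d%:R * ((2 * L + 1) * `|u t| ^+ 2 + C ^+ 2).
      rewrite mulr_natl -[X in _ *+ X](card_ord d) -sumr_const; apply: ler_sum => i _.
      apply: (@le_trans _ _ (2 * (`|u t| * (L * `|u t| + C)))).
        rewrite -mulrA ler_wpM2l// (le_trans (ler_norm _))// normrM.
        by rewrite ler_pM// ?norm_coord_le// (le_trans (norm_coord_le _ _))// Hdu.
      by have := sqr_ge0 (`|u t| - C); rewrite !expr2; nra.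
    move/le_trans; apply; rewrite /c mulrDr lerD2r mulrA ler_wpM2l//.
    rewrite fE -[leRHS]sqr_sqrtr; last by apply: sumr_ge0 => j _; exact: sqr_ge0.
    by rewrite ler_pXn2r ?nnegrE ?sqrtr_ge0//; exact: norm_le_enorm.
  have : E t * df t <= E t * (K * f t + c) by rewrite ler_wpM2l.
  have : E t * c <= c by rewrite ler_piMl.
  by lra.
have ch : {within `[p, q], continuous h}.
  apply/subspace_continuousP => t tpq; apply: cvgB; last first.
    by apply: cvg_within_filter; exact: is_derive_continuous (is_derive_affine _ _ _).
  apply: cvgM.
    have -> : f = fun t => \sum_(i < d) u t 0 i * u t 0 i.
      by apply/funext => r; rewrite fE; under eq_bigr do rewrite expr2.
    apply: cvg_big => [|i _]; first exact: add_continuous.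
    have cui : u r 0 i @[r --> within `[p, q] (nbhs t)] --> u t 0 i.
      move/subspace_continuousP : cu => /(_ t tpq) cut.
      by have := cvg_comp _ _ cut (@coord_continuous R 1 d 0 i (u t)).
    exact: cvgM.
  apply: cvg_within_filter; exact: (is_derive_continuousT HE).
have := nincr_within pq ch Hh dhle.
rewrite /h /= !fctE /GRing.scale/= {2}/E subrr mulr0 oppr0 expR0 mulr1 => hle.
have fq : f q <= expR (K * (q - p)) * (f p + c * (q - p)).
  move: hle; rewrite -ler_pdivrMl ?expR_gt0// -expRN mulrC -/(E q); lra.
have fqle : `|u q| ^+ 2 <= f q.
  rewrite fE -[leRHS]sqr_sqrtr; last by apply: sumr_ge0 => j _; exact: sqr_ge0.
  by rewrite ler_pXn2r ?nnegrE ?sqrtr_ge0//; exact: norm_le_enorm.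
rewrite -[leLHS]ger0_norm// -[leRHS]ger0_norm; last first.
  by rewrite mulr_ge0 ?sqrtr_ge0// addr_ge0.
rewrite -(@ler_pXn2r _ 2)// ?nnegrE// !real_normK ?num_real// exprMn sqr_sqrtr; last first.
  by rewrite mulr_ge0 ?expR_ge0// mulr_ge0 ?ler0n//; lra.
apply: (le_trans fqle); apply: (le_trans fq); rewrite -[leRHS]mulrA.
apply: ler_pM; rewrite ?expR_ge0//.
- rewrite addr_ge0// ?mulr_ge0 ?subr_ge0//.
  by rewrite fE; apply: sumr_ge0 => j _; exact: sqr_ge0.
- by rewrite ler_expR ler_wpM2l.
rewrite -[leRHS]mulrA; apply: (@le_trans _ _ (d%:R * `|u p| ^+ 2 + c * tau)).
  by rewrite lerD// ?fE ?sum_sqr_le// ler_wpM2l.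
rewrite /c -mulrA -mulrDr ler_wpM2l ?ler0n//.
have := normr_ge0 (u p); rewrite !expr2 => up0.
have : 0 <= `|u p| * C by rewrite mulr_ge0.
have : 0 <= tau * (`|u p| * `|u p|) by rewrite !mulr_ge0.
have : 0 <= tau * (`|u p| * C) by rewrite !mulr_ge0.
by have := mulr_ge0 C0 C0; nra.
Qed.

Lemma is_derive_comp_affine (d : nat) (u : R -> 'rV[R]_d) (l : 'rV[R]_d) (c e t : R) :
  is_derive (c * t + e) 1 u l -> is_derive t 1 (fun r => u (c * r + e)) (c *: l).
Proof.
move=> Hu; apply/is_derive_rowP => i; rewrite !mxE.
have Ha := is_derive_affine c e t.
rewrite mulrC; apply: (@is_derive1_comp _ (fun r => u r 0 i)) => //.
exact: is_derive_coord Hu.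
Qed.

(** Backward times are reached by reflecting the curve; they matter because alpha0 involves the flow
    at time - theta. [G] is chosen before the curves, hence is uniform in base points and
    directions. *)
Lemma gronwall (d : nat) (L tau : R) : 0 <= L -> 0 <= tau ->
  exists2 G, 0 <= G & forall (u du : R -> 'rV[R]_d) (p q C : R),
    `|q - p| <= tau -> 0 <= C ->
    (forall t : R, is_derive t 1 u (du t)) ->
    (forall t : R, `|t - p| <= tau -> `|du t| <= L * `|u t| + C) ->
    `|u q| <= G * (`|u p| + C).
Proof.
move=> L0 tau0; have [G G0 HG] := gronwall_within d L0 tau0.
exists G => // u du p q C qp C0 Hu Hdu.
have [pq|/ltW qp'] := leP p q.
  have qpt : q - p <= tau by rewrite -(ger0_norm (_ : 0 <= q - p)) ?subr_ge0.
  apply: (HG _ du) => //; first exact: is_derive_within Hu.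
  move=> t tpq; apply: Hdu; move: tpq.
  by rewrite in_itv/= ler_norml => /andP[pt tq]; lra.
have qpt : p - q <= tau by rewrite -(ger0_norm (_ : 0 <= p - q)) ?subr_ge0// distrC.
pose v r := u (-1 * r + 0); pose dv r := -1 *: du (-1 * r + 0).
have Hv (t : R) : is_derive t 1 v (dv t) by exact: is_derive_comp_affine.
have -> : u q = v (- q) by rewrite /v addr0 mulN1r opprK.
have -> : u p = v (- p) by rewrite /v addr0 mulN1r opprK.
apply: (HG _ dv) => //.
- by rewrite lerN2.
- by rewrite opprK addrC.
- exact: is_derive_within Hv.
move=> t; rewrite in_itv/= => /andP[pt tq].
rewrite /dv normrZ normrN1 mul1r Hdu// addr0 mulN1r ler_norml; lra.
Qed.

End Gronwall.

(** * Antiderivatives and the Cauchy-Lipschitz theorem *)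

Section Antiderivative.
Variable R : realType.
Notation mu := (@lebesgue_measure R).

Lemma antiderivative_gt (f : R -> R) (e : R) : continuous f ->
  exists F : R -> R, forall t, e < t -> is_derive t 1 F (f t).
Proof.
move=> cf; exists (fun x => \int[mu]_(r in `[e, x]) f r)%R => t et.
have fi : mu.-integrable `[e, t + 1] (EFin \o f).
  apply: continuous_compact_integrable; first exact: segment_compact.
  exact: continuous_subspaceT.
have [dF <-] := @continuous_FTC1_closed R f e t (t + 1) (ltr_pwDr ltr01 (lexx t)) fi et (cf t).
by rewrite derive1E; exact: derivableP.
Qed.

Lemma is_derive_eq0_cst (f : R -> R) (p q : R) : p <= q ->
  (forall t, p <= t <= q -> is_derive t 1 f 0) -> f p = f q.
Proof.
move=> pq Hf.
have cf : {within `[p, q], continuous f}.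
  apply: derivable_within_continuous => t; rewrite in_itv/= => tpq.
  by have [] := Hf t tpq.
have [c cpq E] : exists2 c, c \in `[p, q]%R & f q - f p = (fun=> 0) c * (q - p).
  apply: MVT_segment => // t tpq; apply: Hf.
  by rewrite !ltW// (itvP tpq).
by apply/eqP; rewrite eq_sym -subr_eq0 E mul0r.
Qed.

(** An integral starting at a fixed [e] is a primitive only to the right of [e]. The primitives
    based at [- n], normalised to vanish at [s], agree wherever both are valid, and are glued over
    n. *)
Lemma antiderivative1 (f : R -> R) (s x : R) : continuous f ->
  exists2 F : R -> R, F s = x & forall t : R, is_derive t 1 F (f t).
Proof.
move=> cf; have /choice [F HF] n := antiderivative_gt (- n%:R) cf.
pose G n (t : R) := F n t - F n s.
have HG n (t : R) : - n%:R < t -> is_derive t 1 (G n) (f t).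
  move=> nt; have Fn := HF n t nt.
  by rewrite -[f t]subr0; apply: is_deriveB.
have Geq m n (t : R) : - m%:R < s -> - m%:R < t -> - n%:R < s -> - n%:R < t ->
    G m t = G n t.
  move=> ms mt ns nt; pose h := G m - G n.
  have h0 (r : R) : - m%:R < r -> - n%:R < r -> is_derive r 1 h 0.
    move=> mr nr; rewrite -(subrr (f r)).
    by apply: is_deriveB; exact: HG.
  have hs : h s = 0 by rewrite /h /G !fctE !subrr.
  suff : h t = 0 by move=> /eqP; rewrite /h !fctE subr_eq0 => /eqP.
  rewrite -hs; have [ts|/ltW st] := leP t s.
    apply: is_derive_eq0_cst => // r /andP[tr _].
    by apply: h0; apply: lt_le_trans tr.
  symmetry; apply: is_derive_eq0_cst => // r /andP[tr _].
  by apply: h0; apply: lt_le_trans tr.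
pose N (t : R) : nat := (Num.truncn (`|s| + `|t|)).+2.
have Ns n (t : R) : (N t <= n.+1)%N -> - n%:R < s /\ - n%:R < t.
  rewrite ltnS => Nn.
  have : `|s| + `|t| < n%:R.
    by apply: lt_le_trans (truncnS_gt _) _; rewrite ler_nat.
  have := normr_ge0 s; have := normr_ge0 t.
  have := lerNnormlW (lexx `|s|); have := lerNnormlW (lexx `|t|).
  by split; lra.
exists (fun t => x + G (N t) t); first by rewrite /G subrr addr0.
move=> t.
(* Near [t] the varying index [N r] is replaced by the fixed [(N t).+1]: since [- N t < t], the
   extra unit keeps the ball of radius 1 around [t] to the right of [- (N t).+1]. *)
apply: (@near_eq_is_derive _ _ _ (cst x + G (N t).+1)).
  near=> r; rewrite fctE; congr (_ + _).
  have [s1 r1] := Ns (N r) r (leqnSn _).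
  suff [s2 r2] : - (N t).+1%:R < s /\ - (N t).+1%:R < r by exact: Geq.
  have [s2 t2] := Ns (N t) t (leqnSn _).
  suff : t - 1 <= r by rewrite -natr1; split; lra.
  have : ball t 1 r by near: r; exact: nbhsx_ballx.
  rewrite /ball/= => /ltW; rewrite ler_norml => /andP[_]; lra.
rewrite -[f t]add0r; apply: is_deriveD; apply: HG.
by have [] := Ns (N t).+1 t (leq_trans (leqnSn _) (leqnSn _)).
Unshelve. all: by end_near. Qed.

Lemma antiderivative (d : nat) (f : R -> 'rV[R]_d) (s : R) (x : 'rV[R]_d) :
  continuous f ->
  exists2 F : R -> 'rV[R]_d, F s = x & forall t : R, is_derive t 1 F (f t).
Proof.
move=> cf.
have cfi i : continuous (fun t => f t 0 i).
  move=> t; have := cvg_comp _ _ (cf t) (@coord_continuous R 1 d 0 i (f t)).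
  exact.
have /choice [F HF] i : exists F : R -> R,
    F s = x 0 i /\ forall t : R, is_derive t 1 F (f t 0 i).
  by have [F ? ?] := antiderivative1 s (x 0 i) (cfi i); exists F.
exists (fun t => \row_i F i t).
  by apply/rowP => i; rewrite mxE; have [] := HF i.
move=> t; apply/is_derive_rowP => i.
have [_ /(_ t)] := HF i.
by under [X in _ -> is_derive _ _ X _]eq_fun do rewrite mxE.
Qed.

End Antiderivative.

Section Picard.
Variables (R : realType) (d : nat).
Implicit Types (F : R -> 'rV[R]_d -> 'rV[R]_d).

Lemma continuous_lip (T : topologicalType) (F : T -> 'rV[R]_d -> 'rV[R]_d)
    (L : R) (u : T -> 'rV[R]_d) (t : T) : {for t, continuous (F^~ (u t))} ->
  (forall t x y, `|F t x - F t y| <= L * `|x - y|) ->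
  {for t, continuous u} -> {for t, continuous (fun r => F r (u r))}.
Proof.
move=> cF HL cu; apply/cvgrPdist_le => e e0.
pose K := `|L| + 1; have K0 : 0 < K by rewrite /K ltr_wpDl.
near=> r.
have H1 : `|F t (u t) - F r (u t)| <= e / 2.
  by near: r; move/cvgrPdist_le : cF; apply; rewrite divr_gt0.
have H2 : `|u t - u r| <= e / 2 / K.
  by near: r; move/cvgrPdist_le : cu; apply; rewrite !divr_gt0.
rewrite -(subrKA (F r (u t))) (le_trans (ler_normD _ _))// [e]splitr lerD//.
apply: (le_trans (HL _ _ _)); apply: (@le_trans _ _ (K * `|u t - u r|)).
  by rewrite ler_wpM2r// /K (le_trans (ler_norm _))// lerDl.
by rewrite mulrC -ler_pdivlMr.
Unshelve. all: by end_near. Qed.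

Lemma geometric_cvg1 (u : nat -> R) (K : R) :
  (forall n, `|u n.+1 - u n| <= K * 2^-1 ^+ n) ->
  exists l, forall n, `|l - u n| <= 2 * K * 2^-1 ^+ n.
Proof.
move=> Hu.
have K0 : 0 <= K.
  by rewrite -[K]mulr1 -(expr0 2^-1); apply: le_trans (Hu 0%N).
have h0 n : 0 <= 2^-1 ^+ n :> R by rewrite exprn_ge0// invr_ge0.
have cs : cvgn (series (telescope u)).
  apply: normed_cvg; apply: (@series_le_cvg _ _ (geometric K 2^-1)) => //.
  - by move=> n; exact: normr_ge0.
  - by move=> n; rewrite /geometric/= mulr_ge0.
  - apply: is_cvg_geometric_series; rewrite ger0_norm ?invr_ge0//.
    by rewrite invf_lt1// ltr1n.
have cu : cvgn u.
  have -> : u = fun n => u 0%N + series (telescope u) n.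
    by apply/funext => n; exact: eq_sum_telescope.
  by apply: is_cvgD => //; exact: is_cvg_cst.
(* A difference of geometric tails, rather than the first tail alone, makes the induction on [k]
   close. *)
have um n k : `|u (n + k)%N - u n| <= 2 * K * 2^-1 ^+ n - 2 * K * 2^-1 ^+ (n + k).
  elim: k => [|k IH]; first by rewrite addn0 !subrr normr0.
  rewrite -(subrKA (u (n + k)%N)) (le_trans (ler_normD _ _))//.
  rewrite addnS; apply: le_trans (lerD (Hu _) IH) _.
  by rewrite exprS; have := h0 (n + k)%N; lra.
exists (limn u) => n; apply/ler_addgt0Pr => e e0.
have : \forall m \near \oo, `|limn u - u m| <= e.
  by move/cvgrPdist_le : cu; apply.
move=> [m _ Hm].
rewrite -(subrKA (u (n + m)%N)) (le_trans (ler_normD _ _))// addrC lerD//.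
  by apply: le_trans (um n m) _; rewrite gerBl; rewrite !mulr_ge0.
by apply: Hm => /=; rewrite leq_addl.
Qed.

Lemma geometric_cvg (u : nat -> 'rV[R]_d) (K : R) :
  (forall n, `|u n.+1 - u n| <= K * 2^-1 ^+ n) ->
  exists l, forall n, `|l - u n| <= 2 * K * 2^-1 ^+ n.
Proof.
move=> Hu.
have K0 : 0 <= K.
  by rewrite -[K]mulr1 -(expr0 2^-1); apply: le_trans (Hu 0%N).
have /choice [l Hl] i : exists l : R, forall n, `|l - u n 0 i| <= 2 * K * 2^-1 ^+ n.
  apply: geometric_cvg1 => n; apply: le_trans (Hu n).
  by have := norm_coord_le (u n.+1 - u n) i; rewrite !mxE.
exists (\row_i l i) => n; apply: norm_row_le => [|i]; last by rewrite !mxE.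
by rewrite !mulr_ge0// exprn_ge0// invr_ge0.
Qed.

(** The integral of [A exp (k |r - s|)] between s and t is [A / k] times [exp (k |t - s|) - 1]. The
    gain [1 / k] is what makes Picard's map a contraction. *)
Lemma weighted_incr (u du : R -> 'rV[R]_d) (s A k : R) : 0 < k -> 0 <= A ->
  (forall t : R, is_derive t 1 u (du t)) ->
  (forall t : R, `|du t| <= A * expR (k * `|t - s|)) ->
  forall t, `|u t - u s| <= A / k * expR (k * `|t - s|).
Proof.
move=> k0 A0 Hu Hdu t.
have kn : k != 0 by rewrite gt_eqF.
have He (c e r : R) : is_derive r 1 (fun r => expR (c * r + e)) (expR (c * r + e) * c).
  by apply: (@is_derive1_comp _ expR); exact: is_derive_affine.
have HeZ (a c e r : R) : is_derive r 1 (fun r => a * expR (c * r + e)) (a * (expR (c * r + e) * c)).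
  by apply: (@is_deriveZ _ _ _ (fun r => expR (c * r + e)) a).
have Ak : 0 <= A / k by rewrite divr_ge0// ltW.
have [st|/ltW ts] := leP s t.
  have := norm_incr_le st Hu (fun r => HeZ (A / k) k (- (k * s)) r).
  move=> /(_ _)/le_trans; apply.
    move=> r /andP[sr _]; apply: (le_trans (Hdu r)).
    rewrite (ger0_norm (_ : 0 <= r - s)) ?subr_ge0// mulrBr [_ * k]mulrC.
    by rewrite mulrA divfK.
  by rewrite subrr expR0 (ger0_norm (_ : 0 <= t - s)) ?subr_ge0// mulrBr; lra.
rewrite distrC.
have := norm_incr_le ts Hu (fun r => HeZ (- (A / k)) (- k) (k * s) r).
move=> /(_ _)/le_trans; apply.
  move=> r /andP[_ sr]; apply: (le_trans (Hdu r)).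
  rewrite (ler0_norm (_ : r - s <= 0)) ?subr_le0//.
  rewrite (_ : - k * r + k * s = k * - (r - s)); last by ring.
  by rewrite le_eqVlt; apply/orP; left; apply/eqP; field.
rewrite (_ : - k * s + k * s = 0); last by ring.
rewrite expR0 (ler0_norm (_ : t - s <= 0)) ?subr_le0//.
by rewrite (_ : - k * t + k * s = k * - (t - s)); [lra|ring].
Qed.

(** For the distance weighted by [exp (- k |t - s|)] with [k = 2 (|L| + 1)], Picard's map contracts
    by 1/2 on the whole line at once, so that a global solution is obtained without continuation.
    The bound [M] makes the first increment finite in this distance. *)
Lemma picard F (L M s : R) (x0 : 'rV[R]_d) :
  (forall x, continuous (F^~ x)) ->
  (forall t x y, `|F t x - F t y| <= L * `|x - y|) ->
  (forall t, `|F t x0| <= M) ->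
  exists2 X, X s = x0 & forall t : R, is_derive t 1 X (F t (X t)).
Proof.
move=> cF HL HM.
pose k := 2 * (`|L| + 1); have k1 : 1 <= k by rewrite /k; have := normr_ge0 L; lra.
have k0 : 0 < k by apply: lt_le_trans k1.
pose w t := expR (k * `|t - s|).
have HL' t x y : `|F t x - F t y| <= k / 2 * `|x - y|.
  apply: (le_trans (HL _ _ _)); rewrite ler_wpM2r// /k; have := ler_norm L; lra.
have M0 : 0 <= M := le_trans (normr_ge0 _) (HM s).
(* [Ant] has to be total; on a discontinuous [f] it returns [f] itself, a default that is never
   reached since the iterates and their limit are continuous. *)
have /choice [Ant HAnt] (f : R -> 'rV[R]_d) : exists A : R -> 'rV[R]_d,
    continuous f -> A s = x0 /\ forall t : R, is_derive t 1 A (f t).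
  have [cf|ncf] := pselect (continuous f); last by exists f.
  by have [A ? ?] := antiderivative s x0 cf; exists A.
pose P (u : R -> 'rV[R]_d) := Ant (fun t => F t (u t)).
have cFu u : continuous u -> continuous (fun t => F t (u t)).
  by move=> cu t; apply: (continuous_lip (L := L)) => //; [exact: cF|exact: cu].
have HP u : continuous u -> P u s = x0 /\ forall t : R, is_derive t 1 (P u) (F t (u t)).
  by move=> /cFu; exact: HAnt.
have cP u : continuous u -> continuous (P u).
  by move=> /HP [_ /is_derive_continuousT].
pose X n := iter n P (cst x0).
have cX n : continuous (X n).
  by elim: n => [|n IH]; [exact: cst_continuous|exact: cP].
have w0 t : 0 <= w t := expR_ge0 _.
have w1 t : 1 <= w t.
  by rewrite /w -expR0 ler_expR mulr_ge0// ltW.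
have HX n t : `|X n.+1 t - X n t| <= M * 2^-1 ^+ n * w t.
  elim: n t => [|n IH] t.
    have [P0 P1] := HP _ (cX 0%N).
    have := weighted_incr k0 M0 P1 (s := s).
    rewrite /= P0 => /(_ _ t)/le_trans; apply.
      by move=> r; apply: (le_trans (HM r)); rewrite ler_peMr// w1.
    by rewrite expr0 mulr1 ler_wpM2r// ler_pdivrMr// ler_peMr.
  have [P0 P1] := HP _ (cX n); have [Q0 Q1] := HP _ (cX n.+1).
  have Hd (r : R) : is_derive r 1 (P (X n.+1) - P (X n)) (F r (X n.+1 r) - F r (X n r)).
    by apply: is_deriveB.
  have := @weighted_incr _ _ s (k / 2 * (M * 2^-1 ^+ n)) k k0 _ Hd.
  move=> /(_ _ _ t); rewrite !fctE P0 Q0 subrr subr0 => H; apply: le_trans (H _ _) _.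
  - by rewrite !mulr_ge0 ?exprn_ge0 ?invr_ge0// ltW.
  - move=> r; apply: (le_trans (HL' _ _ _)).
    by rewrite -[leRHS]mulrA ler_wpM2l ?IH// divr_ge0// ltW.
  rewrite ler_wpM2r// exprS le_eqVlt; apply/orP; left; apply/eqP.
  by field; rewrite gt_eqF.
have /choice [Y HY] t : exists l, forall n, `|l - X n t| <= 2 * (M * w t) * 2^-1 ^+ n.
  apply: (@geometric_cvg (X^~ t)) => n.
  by apply: (le_trans (HX n t)); rewrite mulrAC.
have half0 (c e : R) : 0 <= c -> 0 < e -> exists n, c * 2^-1 ^+ n <= e.
  move=> c0 e0.
  have : (fun n => c * 2^-1 ^+ n) @ \oo --> c * 0.
    apply: cvgM; [exact: cvg_cst|apply: cvg_expr].
    by rewrite ger0_norm ?invr_ge0// invf_lt1// ltr1n.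
  rewrite mulr0 => /cvgrPdist_le /(_ e e0) [n _ /(_ n (leqnn _))] /=.
  by rewrite sub0r normrN => /(le_trans (ler_norm _)); exists n.
have cY : continuous Y.
  move=> t; apply/cvgrPdist_le => e e0.
  (* [W] dominates the weight on the unit ball around [t], where the convergence is therefore
     uniform and the limit continuous. *)
  pose W := expR (k * (`|t - s| + 1)).
  have [n Hn] : exists n, 2 * (M * W) * 2^-1 ^+ n <= e / 3.
    by apply: half0; rewrite ?divr_gt0// !mulr_ge0 ?expR_ge0.
  have HYW r : `|r - s| <= `|t - s| + 1 -> `|Y r - X n r| <= e / 3.
    move=> rt; apply: le_trans (HY r n) (le_trans _ Hn).
    rewrite ler_wpM2r ?exprn_ge0 ?invr_ge0// ler_wpM2l// ler_wpM2l//.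
    by rewrite ler_expR ler_wpM2l// ltW.
  have nb : \forall r \near t, `|t - r| < 1 by exact: (nbhsx_ballx t 1 ltr01).
  near=> r.
  have H1 : `|X n t - X n r| <= e / 3.
    by near: r; have /cvgrPdist_le := cX n t; apply; rewrite divr_gt0.
  have H2 := HYW t (ler_wpDr ler01 (lexx _)).
  have H3 : `|Y r - X n r| <= e / 3.
    apply: HYW; rewrite -(subrKA t) (le_trans (ler_normD _ _))// addrC lerD//.
  rewrite distrC in H3.
  have -> : Y t - Y r = (Y t - X n t) + (X n t - X n r) + (X n r - Y r).
    by rewrite !addrA !subrK.
  apply: le_trans (ler_normD _ _) _; apply: le_trans (lerD (ler_normD _ _) (lexx _)) _.
  by lra.
have [Z0 Z1] := HP _ cY.
suff YP : P Y = Y by rewrite YP in Z0 Z1; exists Y.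
apply/funext => t; apply/eqP; rewrite eq_sym -subr_eq0 -normr_le0.
apply/ler_addgt0Pr => e e0; rewrite add0r.
have [n Hn] : exists n, 2 * (M * w t) * 2^-1 ^+ n <= e.
  by apply: half0; rewrite ?mulr_ge0.
(* Both [Y] and [P Y] are compared with [X n.+1 = P (X n)]: each is within [M w 2^-n] of it at time
   [t]. *)
apply: le_trans Hn; rewrite -(subrKA (X n.+1 t)).
have [P0 P1] := HP _ (cX n).
have Hd (r : R) : is_derive r 1 (P Y - P (X n)) (F r (Y r) - F r (X n r)).
  by apply: is_deriveB.
have := @weighted_incr _ _ s (k / 2 * (2 * M * 2^-1 ^+ n)) k k0 _ Hd.
move=> /(_ _ _ t); rewrite !fctE P0 Z0 subrr subr0 => H.
have {}H : `|P Y t - P (X n) t| <= M * 2^-1 ^+ n * w t.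
  rewrite (_ : M * 2^-1 ^+ n = k / 2 * (2 * M * 2^-1 ^+ n) / k); last first.
    by field; rewrite gt_eqF.
  apply: H => [|r]; first by rewrite !mulr_ge0 ?exprn_ge0 ?invr_ge0// ltW.
  apply: (le_trans (HL' _ _ _)); rewrite -[leRHS]mulrA ler_wpM2l//.
    by rewrite divr_ge0// ltW.
  apply: le_trans (HY r n) _; rewrite le_eqVlt; apply/orP; left; apply/eqP.
  by rewrite /w; ring.
apply: le_trans (ler_normD _ _) _; apply: le_trans (lerD (HY t n.+1) _) _.
  by rewrite distrC; exact: H.
by rewrite exprS; lra.
Unshelve. all: by end_near. Qed.

End Picard.

(** * Functions with bounded derivatives *)

Section DirectionalDerivatives.
Variables (R : realType) (V : normedModType R).
Implicit Types (f : V -> R) (x y u v : V).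

Lemma is_derive_line f v x (r : R) : (forall y, derivable f y v) ->
  is_derive r 1 (fun h => f (h *: v + x)) ('D_v f (r *: v + x)).
Proof.
move=> df.
have E : (fun h : R => h^-1 *: (((fun h => f (h *: v + x)) \o shift r) (h *: 1) - f (r *: v + x)))
    = (fun h : R => h^-1 *: ((f \o shift (r *: v + x)) (h *: v) - f (r *: v + x))).
  by apply/funext => h /=; rewrite [h *: 1]mulr1 scalerDl addrA.
by apply: DeriveDef; [rewrite /derivable E; exact: df|rewrite /derive E].
Qed.

Lemma directional_MVT f v x (h : R) : (forall y, derivable f y v) ->
  exists2 xi : R, `|xi| <= `|h| & f (h *: v + x) - f x = h * 'D_v f (xi *: v + x).
Proof.
move=> df; pose g r := f (r *: v + x).
have Hg (r : R) : is_derive r 1 g ('D_v f (r *: v + x)) by exact: is_derive_line.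
have cg (A : set R) : {within A, continuous g} by exact: is_derive_within Hg.
have g0 : g 0 = f x by rewrite /g scale0r add0r.
rewrite -g0 -/(g h); have [h0|/ltW h0] := leP 0 h.
  have [c ch ->] := MVT_segment h0 (fun r _ => Hg r) (cg _).
  exists c; last by rewrite subr0 mulrC.
  by rewrite !ger0_norm// (itvP ch).
have [c ch E] := MVT_segment h0 (fun r _ => Hg r) (cg _).
exists c; last by rewrite -opprB E sub0r mulrN opprK mulrC.
by rewrite !ler0_norm ?lerN2// (itvP ch).
Qed.

Lemma directional_taylor f v (L : R) : (forall y, derivable f y v) ->
  (forall x y, `|'D_v f x - 'D_v f y| <= L * `|x - y|) ->
  forall x (h : R), `|f (h *: v + x) - f x - h * 'D_v f x| <= `|L| * `|v| * h ^+ 2.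
Proof.
move=> df HL x h; have [xi xih ->] := directional_MVT x h df.
rewrite -mulrBr normrM; apply: le_trans (ler_wpM2l _ (HL _ _)) _ => //.
rewrite addrK normrZ.
have Lh : L * (`|xi| * `|v|) <= `|L| * (`|h| * `|v|).
  apply: (@le_trans _ _ (`|L| * (`|xi| * `|v|))).
    by rewrite ler_wpM2r ?mulr_ge0// ler_norm.
  by rewrite ler_wpM2l// ler_wpM2r.
apply: le_trans (ler_wpM2l _ Lh) _ => //.
rewrite -(real_normK (num_real h)) le_eqVlt; apply/orP; left; apply/eqP; ring.
Qed.

(** The increment of [f] along [h (u + c v)] is also the increment along [h u] followed by that
    along [h c v]. Taylor expansion of both routes leaves an error of order h^2, and dividing by h
    lets it tend to 0. *)
Lemma derive_linear f u v (c : R) x :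
  (forall w y, derivable f y w) ->
  (forall w, exists L, forall x y, `|'D_w f x - 'D_w f y| <= L * `|x - y|) ->
  'D_(u + c *: v) f x = 'D_u f x + c * 'D_v f x.
Proof.
move=> df dL.
have [Lu HLu] := dL u; have [Lv HLv] := dL v; have [Lw HLw] := dL (u + c *: v).
pose K := `|Lu| * `|u| + `|Lv| * `|v| * c ^+ 2 + `|c| * (`|Lv| * `|u|)
  + `|Lw| * `|u + c *: v|.
have K0 : 0 <= K.
  by do ?apply: addr_ge0; do ?[exact: normr_ge0 | exact: sqr_ge0 | apply: mulr_ge0].
apply/eqP; rewrite -subr_eq0 -normr_le0; set E := (X in `|X|).
apply/ler_addgt0Pr => e e0; rewrite add0r.
pose h := e / (K + 1); have h0 : 0 < h by rewrite divr_gt0// ltr_wpDl.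
have HE : h * `|E| <= h ^+ 2 * K.
  have := directional_taylor (df _) HLu x h; set A := (X in `|X| <= _) => HA.
  have := directional_taylor (df _) HLv (h *: u + x) (h * c).
  set B := (X in `|X| <= _) => HB.
  have := directional_taylor (df _) HLw x h; set C := (X in `|X| <= _) => HC.
  have HD : `|h * c * ('D_v f (h *: u + x) - 'D_v f x)| <=
      `|h * c| * (`|Lv| * (h * `|u|)).
    rewrite normrM ler_wpM2l//; apply: le_trans (HLv _ _) _.
    rewrite addrK normrZ (gtr0_norm h0).
    by rewrite ler_wpM2r ?ler_norm// mulr_ge0// ltW.
  have -> : h * `|E| = `|h * E| by rewrite normrM (gtr0_norm h0).
  have -> : h * E = A + B + h * c * ('D_v f (h *: u + x) - 'D_v f x) - C.
    rewrite /A /B /C /E.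
    have -> : h *: (u + c *: v) + x = (h * c) *: v + (h *: u + x).
      by rewrite scalerDr scalerA [RHS]addrA [_ *: v + _]addrC.
    by ring.
  apply: le_trans (ler_normB _ _) _; apply: le_trans (lerD (ler_normD _ _) HC) _.
  apply: le_trans (lerD (lerD (ler_normD _ _) HD) (lexx _)) _.
  apply: le_trans (lerD (lerD (lerD HA HB) (lexx _)) (lexx _)) _.
  rewrite normrM (gtr0_norm h0) /K le_eqVlt; apply/orP; left; apply/eqP; ring.
have {}HE : `|E| <= h * K by rewrite -(ler_pM2l h0) mulrA -expr2.
apply: (le_trans HE); rewrite /h mulrAC ler_pdivrMr ?ltr_wpDl//.
by rewrite ler_wpM2l ?lerDl// ltW.
Qed.

Lemma bounded_funP (T : Type) (W : normedModType R) (f : T -> W) : bounded_fun f ->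
  exists2 M, 0 <= M & forall z, `|f z| <= M.
Proof.
move=> [M [_ HM]]; exists (`|M| + 1); first by rewrite addr_ge0.
by move=> z; apply: HM => //; rewrite (le_lt_trans (ler_norm M))// ltrDl.
Qed.

Lemma Cb_bounded (m : nat) f : Cb m f -> exists2 M, 0 <= M & forall x, `|f x| <= M.
Proof. by case: m => [|m] [_ /bounded_funP]. Qed.

End DirectionalDerivatives.

(** Finitely many directions packaged with coordinates of size at most the norm, so that the same
    argument serves R x R^d (for b) and R x R x R^d (for a). *)
Definition spanning_family (R : realType) (V : normedModType R) (n : nat)
    (e : 'I_n -> V) (c : 'I_n -> V -> R) : Prop :=
  (forall v, v = \sum_i c i v *: e i) /\ (forall i v, `|c i v| <= `|v|).

Section BoundedDerivatives.
Variables (R : realType) (V : normedModType R) (n : nat).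
Variables (e : 'I_n -> V) (c : 'I_n -> V -> R).
Implicit Types (f : V -> R) (x y u v : V).

(** The point x is reached from y along one direction [e i] at a time; the mean value theorem bounds
    each leg by [|c i (x - y)|] times the bound of that derivative. *)
Lemma Cb1_lipschitz f : spanning_family e c -> Cb 1 f ->
  exists2 L, 0 <= L & forall x y, `|f x - f y| <= L * `|x - y|.
Proof.
move=> [ec c_le] [_ _ Hf].
have /choice [M HM] i : exists M, 0 <= M /\ forall x, `|'D_(e i) f x| <= M.
  by have [M ? ?] := Cb_bounded (m := 0) (Hf (e i)).2; exists M.
exists (\sum_i M i) => [|x y].
  by apply: sumr_ge0 => i _; have [] := HM i.
pose w := x - y.
have tele (s : seq 'I_n) z : `|f (\sum_(i <- s) c i w *: e i + z) - f z| <=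
    \sum_(i <- s) `|c i w| * M i.
  elim: s z => [|i s IH] z; first by rewrite !big_nil add0r subrr normr0.
  rewrite !big_cons -addrA; set z' := (_ + z).
  rewrite -(subrKA (f z')) (le_trans (ler_normD _ _))// lerD//; last exact: IH.
  have [xi _ ->] := directional_MVT z' (c i w) (Hf (e i)).1.
  by rewrite normrM ler_wpM2l//; have [] := HM i.
rewrite -{1}(subrK y x) -/w {1}(ec w); apply: le_trans (tele _ _) _.
rewrite mulr_suml; apply: ler_sum => i _; rewrite mulrC ler_wpM2l ?c_le//.
by have [] := HM i.
Qed.

(** The derivatives along the [e i] are Lipschitz by [Cb1_lipschitz], and linearity in the direction
    extends this to every v with a constant proportional to |v|. The Taylor remainder then follows
    from the mean value theorem on the segment from x to v + x. *)
Lemma Cb2_taylor f : spanning_family e c -> Cb 2 f ->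
  exists2 L, 0 <= L &
    [/\ forall x u v (k : R), 'D_(u + k *: v) f x = 'D_u f x + k * 'D_v f x,
        forall x v, `|'D_v f x| <= L * `|v|,
        forall x y v, `|'D_v f x - 'D_v f y| <= L * `|x - y| * `|v|,
        forall x v, `|f (v + x) - f x - 'D_v f x| <= L * `|v| ^+ 2 &
        forall x y, `|f x - f y| <= L * `|x - y|].
Proof.
move=> ecP Hf2; have [ec c_le] := ecP; have [cf bf Hf] := Hf2.
have Hf1 : Cb 1 f.
  split => // v; have [dv [cv bv _]] := Hf v; split=> //; exact/And3.
have dfv w y : derivable f y w by have [] := Hf w.
have dlip w : exists2 L, 0 <= L & forall x y, `|'D_w f x - 'D_w f y| <= L * `|x - y|.
  by apply: Cb1_lipschitz => //; have [] := Hf w.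
have lin x u v (k : R) : 'D_(u + k *: v) f x = 'D_u f x + k * 'D_v f x.
  by apply: derive_linear => // w; have [L _ ?] := dlip w; exists L.
have Dsum x v : 'D_v f x = \sum_i c i v * 'D_(e i) f x.
  rewrite {1}(ec v).
  elim/big_ind2 : _ => [|a1 a2 b1 b2 <- <-|i _]; first exact: derive0.
    by have := lin x a2 b2 1; rewrite scale1r mul1r.
  by have := lin x 0 (e i) (c i v); rewrite !add0r derive0 add0r.
have /choice [L1 HL1] i : exists L, 0 <= L /\
    forall x y, `|'D_(e i) f x - 'D_(e i) f y| <= L * `|x - y|.
  by have [L ? ?] := dlip (e i); exists L.
have /choice [M HM] i : exists M, 0 <= M /\ forall x, `|'D_(e i) f x| <= M.
  by have [M ? ?] := Cb_bounded (m := 1) (Hf (e i)).2; exists M.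
have [L0 L00 HL0] := Cb1_lipschitz ecP Hf1.
pose L1s := \sum_i L1 i; pose Ms := \sum_i M i.
have L1s0 : 0 <= L1s by apply: sumr_ge0 => i _; have [] := HL1 i.
have Ms0 : 0 <= Ms by apply: sumr_ge0 => i _; have [] := HM i.
have Dlip x y v : `|'D_v f x - 'D_v f y| <= L1s * `|x - y| * `|v|.
  rewrite !Dsum -sumrB; apply: le_trans (ler_norm_sum _ _ _) _.
  rewrite /L1s !mulr_suml; apply: ler_sum => i _.
  rewrite -mulrBr normrM mulrC ler_pM//.
  by have [_ ->] := HL1 i.
exists (L0 + L1s + Ms); first by rewrite !addr_ge0.
split => //.
- move=> x v; apply: (@le_trans _ _ (Ms * `|v|)); last first.
    by rewrite ler_wpM2r// lerDr addr_ge0.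
  rewrite Dsum; apply: le_trans (ler_norm_sum _ _ _) _.
  rewrite /Ms mulr_suml; apply: ler_sum => i _.
  by rewrite normrM mulrC ler_pM//; have [_ ->] := HM i.
- move=> x y v; apply: le_trans (Dlip _ _ _) _.
  by rewrite !ler_wpM2r// -addrA addrCA lerDl addr_ge0.
- move=> x v; have [xi xi1] := directional_MVT x 1 (dfv v).
  rewrite !scale1r mul1r => ->; apply: le_trans (Dlip _ _ _) _.
  rewrite addrK normrZ -mulrA.
  apply: (@le_trans _ _ (L1s * `|v| ^+ 2)).
    rewrite ler_wpM2l// expr2 ler_wpM2r// ler_piMl//.
    by rewrite (le_trans xi1)// normr1.
  by rewrite ler_wpM2r ?sqr_ge0// -addrA addrCA lerDl addr_ge0.
- move=> x y; apply: le_trans (HL0 _ _) _.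
  by rewrite ler_wpM2r// -addrA lerDl addr_ge0.
Qed.

End BoundedDerivatives.

Section PairNorm.
Variables (R : realType) (V W : normedModType R).
Implicit Types (x : V) (y : W).

Lemma normr_pairE x y : `|(x, y)| = Num.max `|x| `|y|.
Proof. by []. Qed.

Lemma norm_fst_le (p : V * W) : `|p.1| <= `|p|.
Proof. by case: p => x y; rewrite normr_pairE le_max lexx. Qed.

Lemma norm_snd_le (p : V * W) : `|p.2| <= `|p|.
Proof. by case: p => x y; rewrite normr_pairE le_max lexx orbT. Qed.

Lemma norm_pair_le x y : `|(x, y)| <= `|x| + `|y|.
Proof. by rewrite normr_pairE ge_max lerDl lerDr !normr_ge0. Qed.

End PairNorm.

Section SpanningFamilies.
Variable R : realType.

Lemma spanning_real : spanning_family (V := R) (fun _ : 'I_1 => 1) (fun _ v => v).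
Proof. by split=> // v; rewrite big_ord1 [_ *: _]mulr1. Qed.

Lemma spanning_row (d : nat) :
  spanning_family (V := 'rV[R]_d) (fun i => delta_mx 0 i) (fun i v => v 0 i).
Proof.
by split=> [v|i v]; [exact: row_sum_delta|exact: norm_coord_le].
Qed.

Lemma spanning_pair (V W : normedModType R) (m n : nat)
    (e : 'I_m -> V) (c : 'I_m -> V -> R) (e' : 'I_n -> W) (c' : 'I_n -> W -> R) :
  spanning_family e c -> spanning_family e' c' ->
  spanning_family (V := (V * W)%type)
    (fun i => match fintype.split i with inl j => (e j, 0) | inr j => (0, e' j) end)
    (fun i p => match fintype.split i with inl j => c j p.1 | inr j => c' j p.2 end).
Proof.
move=> [ec c_le] [ec' c'_le]; split; last first.
  move=> i v; case: (fintype.split i) => j.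
    exact: le_trans (c_le _ _) (norm_fst_le _).
  exact: le_trans (c'_le _ _) (norm_snd_le _).
move=> [x y]; rewrite big_split_ord/=.
have -> : \sum_(i < m) match fintype.split (lshift n i) with
    | inl j => c j x | inr j => c' j y end *:
    (match fintype.split (lshift n i) with inl j => (e j, 0) | inr j => (0, e' j) end : V * W)
    = (x, 0).
  rewrite [in RHS](ec x); elim/big_ind2 : _ => [//|? a ? b -> ->|i _].
    by rewrite -[X in _ = (_, X)](addr0 0).
  by rewrite (unsplitK (inl i)) -[X in _ = (_, X)](scaler0 _ (c i x)).
have -> : \sum_(i < n) match fintype.split (rshift m i) with
    | inl j => c j x | inr j => c' j y end *:
    (match fintype.split (rshift m i) with inl j => (e j, 0) | inr j => (0, e' j) end : V * W)
    = (0, y).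
  rewrite [in RHS](ec' y); elim/big_ind2 : _ => [//|? a ? b -> ->|i _].
    by rewrite -[X in _ = (X, _)](addr0 0).
  by rewrite (unsplitK (inr i)) -[X in _ = (X, _)](scaler0 _ (c' i y)).
by congr pair; rewrite /= ?addr0 ?add0r.
Qed.

End SpanningFamilies.

(** [Db p] plays the role of the differential of [b] at [p]. These estimates, with one common
    constant, are the form in which the C_b^2 hypothesis is used from here on. *)
Definition taylor_field (R : realType) (V W : normedModType R) (L : R) (b : V -> W)
    (Db : V -> V -> W) : Prop :=
  [/\ forall p u v (k : R), Db p (u + k *: v) = Db p u + k *: Db p v,
      forall p v, `|Db p v| <= L * `|v|,
      forall p q v, `|Db p v - Db q v| <= L * `|p - q| * `|v|,
      forall p v, `|b (v + p) - b p - Db p v| <= L * `|v| ^+ 2 &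
      (forall p q, `|b p - b q| <= L * `|p - q|) /\ (forall p, `|b p| <= L)].

Section RowFields.
Variables (R : realType) (V : normedModType R) (n d : nat).
Variables (e : 'I_n -> V) (c : 'I_n -> V -> R).
Implicit Types (b : V -> 'rV[R]_d).

Lemma Cb1_row b : spanning_family e c -> (forall i, Cb 1 (fun p => b p 0 i)) ->
  exists L, [/\ 0 <= L, forall p q, `|b p - b q| <= L * `|p - q| &
                forall p, `|b p| <= L].
Proof.
move=> ecP Hb.
have /choice [L HL] i : exists L, 0 <= L /\
    forall p q, `|b p 0 i - b q 0 i| <= L * `|p - q|.
  by have [L ? ?] := Cb1_lipschitz ecP (Hb i); exists L.
have /choice [M HM] i : exists M, 0 <= M /\ forall p, `|b p 0 i| <= M.
  by have [M ? ?] := Cb_bounded (m := 1) (Hb i); exists M.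
have S0 : 0 <= \sum_i (L i + M i).
  by apply: sumr_ge0 => i _; rewrite addr_ge0//; [have [] := HL i|have [] := HM i].
have LS i : L i <= \sum_i (L i + M i) /\ M i <= \sum_i (L i + M i).
  have L0 j : 0 <= L j by have [] := HL j.
  have M0 j : 0 <= M j by have [] := HM j.
  have R0 : 0 <= \sum_(j | j != i) (L j + M j).
    by apply: sumr_ge0 => j _; rewrite addr_ge0.
  by rewrite (bigD1 i)//=; split; have := L0 i; have := M0 i; lra.
exists (\sum_i (L i + M i)); split => // [p q|p].
- apply: norm_row_le => [|i]; first by rewrite mulr_ge0.
  rewrite !mxE; apply: le_trans ((HL i).2 _ _) _.
  by rewrite ler_wpM2r//; have [] := LS i.
- apply: norm_row_le => // i; apply: le_trans ((HM i).2 _) _.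
  by have [] := LS i.
Qed.

Lemma Cb2_row b : spanning_family e c -> (forall i, Cb 2 (fun p => b p 0 i)) ->
  exists2 L, 0 <= L & exists Db, taylor_field L b Db.
Proof.
move=> ecP Hb; pose Db p v : 'rV[R]_d := \row_i 'D_v (fun p => b p 0 i) p.
have /choice [L HL] i : exists L, 0 <= L /\
    [/\ forall p u v (k : R), Db p (u + k *: v) 0 i = Db p u 0 i + k * Db p v 0 i,
        forall p v, `|Db p v 0 i| <= L * `|v|,
        forall p q v, `|Db p v 0 i - Db q v 0 i| <= L * `|p - q| * `|v|,
        forall p v, `|b (v + p) 0 i - b p 0 i - Db p v 0 i| <= L * `|v| ^+ 2 &
        (forall p q, `|b p 0 i - b q 0 i| <= L * `|p - q|) /\
        forall p, `|b p 0 i| <= L].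
  have [L L0 [H1 H2 H3 H4 H5]] := Cb2_taylor ecP (Hb i).
  have [M M0 HM] := Cb_bounded (m := 2) (Hb i).
  have LM : L <= L + M by rewrite lerDl.
  exists (L + M); split; first by rewrite addr_ge0.
  split=> [p u v k|p v|p q v|p v|]; rewrite ?mxE.
  - exact: H1.
  - by apply: le_trans (H2 _ _) _; rewrite ler_wpM2r.
  - by apply: le_trans (H3 _ _ _) _; rewrite !ler_wpM2r.
  - by apply: le_trans (H4 _ _) _; rewrite ler_wpM2r ?exprn_ge0.
  split=> [p q|p]; first by apply: le_trans (H5 _ _) _; rewrite ler_wpM2r.
  by apply: le_trans (HM _) _; rewrite lerDr.
pose S := \sum_i L i.
have L0 i : 0 <= L i by have [] := HL i.
have S0 : 0 <= S by apply: sumr_ge0.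
have LS i : L i <= S by rewrite /S (bigD1 i)//= lerDl sumr_ge0.
exists S => //; exists Db; split=> [p u v k|p v|p q v|p v|].
- by apply/rowP => i; have [_ [H _ _ _ _]] := HL i; rewrite H !mxE.
- apply: norm_row_le => [|i]; first by rewrite mulr_ge0.
  have [_ [_ H _ _ _]] := HL i; apply: le_trans (H _ _) _.
  by rewrite ler_wpM2r.
- apply: norm_row_le => [|i]; first by rewrite !mulr_ge0.
  have [_ [_ _ H _ _]] := HL i; have := H p q v; rewrite !mxE => /le_trans; apply.
  by rewrite !ler_wpM2r.
- apply: norm_row_le => [|i]; first by rewrite mulr_ge0 ?exprn_ge0.
  have [_ [_ _ _ H _]] := HL i; have := H p v; rewrite !mxE => /le_trans; apply.
  by rewrite ler_wpM2r ?exprn_ge0.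
split=> [p q|p]; apply: norm_row_le => [|i]; rewrite ?mulr_ge0//.
  have [_ [_ _ _ _ [H _]]] := HL i; rewrite !mxE; apply: le_trans (H _ _) _.
  by rewrite ler_wpM2r.
by have [_ [_ _ _ _ [_ H]]] := HL i; apply: le_trans (H _) _.
Qed.

End RowFields.

(** * Differentiability of the flow *)

Section QuadraticRemainder.
Variable R : realType.

(** Gronwall's lemma delivers quadratic remainders, and this criterion turns them into
    differentiability. *)
Lemma is_diff_quadratic (V W : normedModType R) (f D : V -> W) (K : R) (x : V) :
  (forall (u v : V) (k : R), D (u + k *: v) = D u + k *: D v) ->
  (forall v, `|D v| <= K * `|v|) ->
  (forall v, `|f (v + x) - f x - D v| <= K * `|v| ^+ 2) ->
  is_diff x f D.
Proof.
move=> Dlin Dbnd Htay.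
have lin : linear D by move=> k u v; rewrite [_ + v]addrC Dlin addrC.
pose Dm := GRing.isLinear.Build _ _ _ _ _ lin.
pose Dl : {linear _ -> _} := HB.pack D Dm.
have cD : continuous Dl.
  apply: bounded_linear_continuous; apply/linear_boundedP.
  near=> r; move=> v; apply: le_trans (Dbnd v) _; rewrite ler_wpM2r//.
have Ho : f \o shift x = cst (f x) + Dl +o_ 0 id.
  apply/eqaddoP => e e0; near=> v.
  have := Htay v; rewrite !fctE/= opprD addrA => /le_trans; apply.
  rewrite expr2 mulrA ler_wpM2r//.
  have vK : `|v| <= e / (`|K| + 1).
    near: v; apply: nbhs0_le; rewrite divr_gt0// ltr_wpDl//.
  move: vK; rewrite ler_pdivlMr ?ltr_wpDl// => vK.
  apply: le_trans vK; rewrite mulrC ler_wpM2l//.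
  by rewrite (le_trans (ler_norm _))// lerDl.
have dE : 'd f x = Dl :> (V -> W) by exact: diff_unique.
by apply: DiffDef => //; apply/diff_locallyP; rewrite dE; split.
Unshelve. all: by end_near. Qed.

Lemma is_derive_quadratic (V : normedModType R) (u : R -> V) (t : R) (l : V) (K : R) :
  (forall h : R, `|u (h + t) - u t - h *: l| <= K * h ^+ 2) -> is_derive t 1 u l.
Proof.
move=> Hu.
have H : is_diff t u (fun h => h *: l).
  apply: (@is_diff_quadratic R V u (fun h : R => h *: l) (`|K| + `|l|)) => [v w k|v|v].
  - by rewrite scalerDl scalerA.
  - by rewrite normrZ mulrC ler_wpM2r// lerDr.
  - apply: le_trans (Hu v) _; rewrite real_normK ?num_real// ler_wpM2r ?sqr_ge0//.
    by rewrite (le_trans (ler_norm _))// lerDl.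
apply: DeriveDef; first exact/derivable1_diffP.
by rewrite deriveE// diff_val scale1r.
Qed.

Lemma lipschitz_continuous (V W : normedModType R) (f : V -> W) (K : R) :
  (forall x y, `|f x - f y| <= K * `|x - y|) -> continuous f.
Proof.
move=> Hf x; apply/cvgrPdist_le => e e0; near=> y.
apply: le_trans (Hf _ _) _; apply: (@le_trans _ _ ((`|K| + 1) * `|x - y|)).
  by rewrite ler_wpM2r// (le_trans (ler_norm _))// lerDl.
rewrite mulrC -ler_pdivlMr ?ltr_wpDl//.
near: y; apply: cvgr_dist_le; first exact: cvg_id.
by rewrite divr_gt0// ltr_wpDl.
Unshelve. all: by end_near. Qed.

Lemma local_lipschitz_continuous (W : normedModType R) (f : R -> W) :
  (forall tau, exists K, forall x y, `|x| <= tau -> `|y| <= tau ->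
     `|f x - f y| <= K * `|x - y|) -> continuous f.
Proof.
move=> Hf x; have [K HK] := Hf (`|x| + 1); apply/cvgrPdist_le => e e0.
have nb : \forall y \near x, `|x - y| < 1 by exact: (nbhsx_ballx x 1 ltr01).
near=> y.
have xy : `|x - y| < 1 by near: y; exact: nb.
apply: le_trans (HK _ _ _ _) _; first by rewrite lerDl.
  have -> : y = x - (x - y) by rewrite subKr.
  by rewrite (le_trans (ler_normB _ _))// lerD// ltW.
apply: (@le_trans _ _ ((`|K| + 1) * `|x - y|)).
  by rewrite ler_wpM2r// (le_trans (ler_norm _))// lerDl.
rewrite mulrC -ler_pdivlMr ?ltr_wpDl//.
near: y; apply: cvgr_dist_le; first exact: cvg_id.
by rewrite divr_gt0// ltr_wpDl.
Unshelve. all: by end_near. Qed.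

Lemma is_derive_shiftr (d : nat) (u : R -> 'rV[R]_d) (l : 'rV[R]_d) (e t : R) :
  is_derive (t + e) 1 u l -> is_derive t 1 (fun r => u (r + e)) l.
Proof.
move=> Hu; have -> : (fun r => u (r + e)) = fun r => u (1 * r + e).
  by apply/funext => r; rewrite mul1r.
by rewrite -[l]scale1r; apply: is_derive_comp_affine; rewrite mul1r.
Qed.

(** The uniqueness principle for differences of two solutions; with L = 0 it says that a curve with
    zero derivative that vanishes at one point vanishes everywhere. *)
Lemma gronwall_eq0 (d : nat) (L : R) (u du : R -> 'rV[R]_d) (p : R) : 0 <= L ->
  (forall t : R, is_derive t 1 u (du t)) ->
  (forall t : R, `|du t| <= L * `|u t|) -> u p = 0 -> forall t, u t = 0.
Proof.
move=> L0 Hu Hdu up t.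
have [G _ HG] := gronwall d L0 (normr_ge0 (t - p)).
apply/eqP; rewrite -normr_le0.
have := HG u du p t 0 (lexx _) (lexx _) Hu.
by rewrite up normr0 addr0 mulr0; apply => r _; rewrite addr0.
Qed.

(** The target type is arbitrary so that [f] may take values in functions of (t, z): one reduced
    angle then serves all points simultaneously. *)
Lemma periodic_reduce (T : Type) (f : R -> T) (p : R) : 0 < p -> (forall x, f (x + p) = f x) ->
  forall x, exists2 y, 0 <= y <= p & f x = f y.
Proof.
move=> p0 fp x.
have fpn (n : nat) y : f (y + p *+ n) = f y.
  by elim: n y => [|n IH] y; rewrite ?mulr0n ?addr0// mulrS addrA IH fp.
have fpz (k : int) y : f (y + p *~ k) = f y.
  case: k => n; first exact: fpn.
  by rewrite NegzE mulrNz -(fpn n.+1 (y - _)) pmulrn subrK.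
pose k := Num.floor (x / p).
exists (x - p *~ k); last by rewrite -[in LHS](subrK (p *~ k) x) fpz.
have := floor_itv (x / p).
rewrite -/k ler_pdivlMr// ltr_pdivrMr// => /andP[k1 k2].
rewrite -mulrzl; apply/andP; split; first by rewrite subr_ge0.
by move: k2; rewrite intrD mulrDl mul1r lerBlDl => /ltW.
Qed.

End QuadraticRemainder.

Ltac nonneg := by do ?[assumption | exact: normr_ge0 | exact: ler01
  | exact: sqr_ge0 | apply: addr_ge0 | apply: mulr_ge0].

Section Flow.
Variables (R : realType) (d : nat).
Notation P := (R * 'rV[R]_d)%type.
Variables (b : R -> 'rV[R]_d -> 'rV[R]_d) (Z : R -> R -> 'rV[R]_d -> 'rV[R]_d).
Variables (L : R) (Db : P -> P -> 'rV[R]_d).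
Hypothesis L0 : 0 <= L.
Hypothesis bT : taylor_field L (fun p : P => b p.1 p.2) Db.
Hypothesis Zf : is_flow b Z.
Hypothesis Zp : forall t z, periodic (fun theta => Z t theta z) (2 * pi).
Implicit Types (p q v w : P) (t theta phi tau : R) (y z : 'rV[R]_d).

Let Dlin p v w (k : R) : Db p (v + k *: w) = Db p v + k *: Db p w.
Proof. by case: bT. Qed.

Let Dbnd p v : `|Db p v| <= L * `|v|. Proof. by case: bT. Qed.

Let Dlip p q v : `|Db p v - Db q v| <= L * `|p - q| * `|v|. Proof. by case: bT. Qed.

Let btay p v : `|b (v + p).1 (v + p).2 - b p.1 p.2 - Db p v| <= L * `|v| ^+ 2.
Proof. by case: bT => _ _ _ H _; exact: H. Qed.

Let blip p q : `|b p.1 p.2 - b q.1 q.2| <= L * `|p - q|.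
Proof. by case: bT => _ _ _ _ [H _]; exact: H. Qed.

Let bbnd t z : `|b t z| <= L.
Proof. by case: bT => _ _ _ _ [_ H]; exact: (H (t, z)). Qed.

Let DB p v w : Db p v - Db p w = Db p (v - w).
Proof. by have := Dlin p v w (-1); rewrite !scaleN1r. Qed.

Let Z0 t z : Z t 0 z = z. Proof. by have [] := Zf t z. Qed.

Let Zd t z theta : is_derive theta 1 (fun th => Z t th z) (b t (Z t theta z)).
Proof. by have [] := Zf t z. Qed.

Let pairB t z theta y : (t, z) - (theta, y) = (t - theta, z - y) :> P.
Proof. by []. Qed.

(** For frozen t the equation is autonomous in theta, and both sides, as functions of the first
    time, solve it with the same value at 0. *)
Lemma flow_group t theta phi z : Z t (theta + phi) z = Z t theta (Z t phi z).
Proof.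
pose u th := Z t (th + phi) z - Z t th (Z t phi z).
apply/eqP; rewrite -subr_eq0 -/(u theta); apply/eqP.
apply: (@gronwall_eq0 _ _ L u (fun th => b t (Z t (th + phi) z) - b t (Z t th (Z t phi z))) 0) => //.
- move=> th; apply: is_deriveB; last exact: Zd.
  by apply: (@is_derive_shiftr _ _ (fun r => Z t r z)); exact: Zd.
- move=> th; have := blip (t, Z t (th + phi) z) (t, Z t th (Z t phi z)).
  by rewrite pairB subrr normr_pairE normr0 max_r.
by rewrite /u add0r Z0 subrr.
Qed.

Lemma flow_periodic theta :
  (fun t z => Z t (theta + 2 * pi) z) = (fun t z => Z t theta z).
Proof. by apply/funext => t; apply/funext => z; exact: Zp. Qed.

Lemma two_pi_gt0 : 0 < 2 * pi :> R.
Proof. by rewrite mulr_gt0 ?pi_gt0. Qed.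

(** Gronwall's lemma alone would give a constant exponential in |theta|; it is applied after
    reducing the angle to [0, 2 pi]. The difference of the parameters acts as a forcing term
    [L |t - t'|]. *)
Lemma flow_lipschitz : exists2 C, 0 <= C &
  forall theta p q, `|Z p.1 theta p.2 - Z q.1 theta q.2| <= C * `|p - q|.
Proof.
have [G G0 HG] := gronwall d L0 (ltW two_pi_gt0).
exists (G * (1 + L)); first nonneg.
move=> theta [t z] [t' z'] /=.
have [phi phi2 E] := periodic_reduce two_pi_gt0 flow_periodic theta.
have -> : Z t theta z = Z t phi z by have := congr1 (fun f => f t z) E.
have -> : Z t' theta z' = Z t' phi z' by have := congr1 (fun f => f t' z') E.
have := HG (fun th => Z t th z - Z t' th z')
  (fun th => b t (Z t th z) - b t' (Z t' th z')) 0 phi (L * `|t - t'|).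
rewrite !Z0 subr0 ger0_norm; last by case/andP: phi2.
move=> /(_ _ _ _ _)/le_trans; apply.
- by case/andP: phi2.
- nonneg.
- by move=> th; apply: is_deriveB; exact: Zd.
- move=> th _; apply: le_trans (blip (t, Z t th z) (t', Z t' th z')) _.
  by rewrite -mulrDr ler_wpM2l// [leRHS]addrC norm_pair_le.
rewrite -mulrA ler_wpM2l// mulrDl mul1r pairB.
by rewrite lerD// ?ler_wpM2l// ?(norm_snd_le (t - t', z - z')) ?(norm_fst_le (t - t', z - z')).
Qed.

(** The flow on the extended space R x R^d, where t is a coordinate with zero velocity. *)
Definition orbit theta p : P := (p.1, Z p.1 theta p.2).

Lemma orbit0 p : orbit 0 p = p.
Proof. by case: p => t z; rewrite /orbit Z0. Qed.

Lemma orbit_group theta phi p : orbit (theta + phi) p = orbit theta (orbit phi p).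
Proof. by rewrite /orbit /= flow_group. Qed.

Lemma orbit_lipschitz : exists2 C, 0 <= C &
  forall theta p q, `|orbit theta p - orbit theta q| <= C * `|p - q|.
Proof.
have [C C0 HC] := flow_lipschitz; exists (1 + C); first by rewrite addr_ge0.
move=> theta p q; rewrite /orbit pairB; apply: le_trans (norm_pair_le _ _) _.
by rewrite mulrDl mul1r lerD// (norm_fst_le (p - q)).
Qed.

Lemma flow_time_lipschitz t z theta phi :
  `|Z t theta z - Z t phi z| <= L * `|theta - phi|.
Proof. by apply: (norm_incr_lin (fun r => Zd t z r)) => r _; exact: bbnd. Qed.

Lemma orbit_time_lipschitz p theta phi :
  `|orbit theta p - orbit phi p| <= L * `|theta - phi|.
Proof.
rewrite /orbit pairB subrr normr_pairE normr0 max_r//.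
exact: flow_time_lipschitz.
Qed.

(** Only the space component of the transported tangent vector is recorded: its time component stays
    equal to [v.1], because the flow does not move t. *)
Definition variational (m : R -> P -> P -> 'rV[R]_d) := forall p v, m 0 p v = v.2 /\
  forall theta, is_derive theta 1 (fun th => m th p v)
    (Db (orbit theta p) (v.1, m theta p v)).

Lemma variational_exists : exists m, variational m.
Proof.
have H pv : exists u : R -> 'rV[R]_d, u 0 = pv.2.2 /\ forall theta,
    is_derive theta 1 u (Db (orbit theta pv.1) (pv.2.1, u theta)).
  case: pv => p v /=.
  have [|||u u0 u1] := @picard R d (fun th x => Db (orbit th p) (v.1, x)) L
    (L * `|(v.1, v.2)|) 0 v.2.
  - move=> x; apply: (@lipschitz_continuous _ _ _ _ (L * L * `|(v.1, x)|)) => r r' /=.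
    apply: le_trans (Dlip _ _ _) _.
    have -> : L * L * `|(v.1, x)| * `|r - r'| = L * (L * `|r - r'|) * `|(v.1, x)|.
      by ring.
    by rewrite ler_wpM2r// ler_wpM2l// orbit_time_lipschitz.
  - move=> th x y; rewrite DB; apply: le_trans (Dbnd _ _) _.
    by rewrite pairB subrr normr_pairE normr0 max_r.
  - by move=> th; exact: Dbnd.
  by exists u.
have /choice [m Hm] := H; exists (fun th p v => m (p, v) th).
by move=> p v; have := Hm (p, v).
Qed.

Variable m : R -> P -> P -> 'rV[R]_d.
Hypothesis mv : variational m.

Let m0 p v : m 0 p v = v.2. Proof. by have [] := mv p v. Qed.

Let md p v theta : is_derive theta 1 (fun th => m th p v)
  (Db (orbit theta p) (v.1, m theta p v)).
Proof. by have [] := mv p v. Qed.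

Lemma variational_unique (u1 u2 : R -> 'rV[R]_d) p tau :
  (forall theta, is_derive theta 1 u1 (Db (orbit theta p) (tau, u1 theta))) ->
  (forall theta, is_derive theta 1 u2 (Db (orbit theta p) (tau, u2 theta))) ->
  u1 0 = u2 0 -> forall theta, u1 theta = u2 theta.
Proof.
move=> H1 H2 H0 theta; apply/eqP; rewrite -subr_eq0; apply/eqP.
apply: (@gronwall_eq0 _ _ L (fun r => u1 r - u2 r) (fun r => Db (orbit r p) (tau, u1 r) -
  Db (orbit r p) (tau, u2 r)) 0) => //.
- move=> r; rewrite DB; apply: le_trans (Dbnd _ _) _.
  by rewrite pairB subrr normr_pairE normr0 max_r.
- by rewrite H0 subrr.
Qed.

Lemma variational_linear theta p v w (k : R) :
  m theta p (v + k *: w) = m theta p v + k *: m theta p w.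
Proof.
apply: (@variational_unique (fun r => m r p (v + k *: w))
  (fun r => m r p v + k *: m r p w) p (v + k *: w).1) => [r|r|].
- exact: md.
- have -> : ((v + k *: w).1, m r p v + k *: m r p w) =
    (v.1, m r p v) + k *: (w.1, m r p w) :> P by [].
  rewrite Dlin; apply: is_deriveD; first exact: md.
  by apply: is_deriveZ; exact: md.
by rewrite !m0.
Qed.

(** The chain rule for [orbit (phi + theta)], obtained from uniqueness before the flow is known to
    be differentiable. With [phi = - theta] it inverts [m theta]. *)
Lemma variational_cocycle theta phi p v :
  m phi (orbit theta p) (v.1, m theta p v) = m (phi + theta) p v.
Proof.
apply: (@variational_unique (fun r => m r (orbit theta p) (v.1, m theta p v))
  (fun r => m (r + theta) p v) (orbit theta p) v.1) => [r|r|].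
- exact: md.
- rewrite -orbit_group; apply: (@is_derive_shiftr _ _ (fun r => m r p v)); exact: md.
by rewrite m0 add0r.
Qed.

Lemma variational_bound tau : 0 <= tau -> exists2 G, 0 <= G &
  forall theta p v, `|theta| <= tau -> `|m theta p v| <= G * `|v|.
Proof.
move=> tau0; have [G G0 HG] := gronwall d L0 tau0.
exists (G * (1 + L)); first nonneg.
move=> theta p v th.
have := HG (fun r => m r p v) (fun r => Db (orbit r p) (v.1, m r p v)) 0 theta (L * `|v.1|).
rewrite m0 subr0 => /(_ th) H; apply: le_trans (H _ _ _) _.
- nonneg.
- by move=> r; exact: md.
- move=> r _; apply: le_trans (Dbnd _ _) _.
  by rewrite -mulrDr ler_wpM2l// [leRHS]addrC norm_pair_le.
by rewrite -mulrA ler_wpM2l// mulrDl mul1r lerD ?norm_snd_le// ler_wpM2l// norm_fst_le.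
Qed.

Lemma variational_lipschitz tau : 0 <= tau -> exists2 K, 0 <= K &
  forall theta theta' p q v w, `|theta| <= tau -> `|theta'| <= tau ->
    `|m theta p v - m theta' q w| <=
      K * (`|theta - theta'| * `|w| + `|p - q| * `|v| + `|v - w|).
Proof.
move=> tau0; have [G G0 HG] := gronwall d L0 tau0.
have [C C0 HC] := orbit_lipschitz; have [B B0 HB] := variational_bound tau0.
(* [L] is the Lipschitz constant of [Db] in its base point, [C] that of the orbits, and
   [(1 + B) |v|] bounds the transported vector [(v.1, m r p v)]. *)
pose A := L * C * (1 + B); have A0 : 0 <= A by nonneg.
have H1 theta p q v w : `|theta| <= tau ->
    `|m theta p v - m theta q w| <= G * (1 + L + A) * (`|p - q| * `|v| + `|v - w|).
  move=> th.
  have := HG (fun r => m r p v - m r q w)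
    (fun r => Db (orbit r p) (v.1, m r p v) - Db (orbit r q) (w.1, m r q w))
    0 theta (A * `|p - q| * `|v| + L * `|v - w|).
  rewrite !m0 subr0 => /(_ th) H; apply: le_trans (H _ _ _) _.
  - nonneg.
  - by move=> r; apply: is_deriveB; exact: md.
  - move=> r; rewrite subr0 => rt; rewrite -(subrKA (Db (orbit r q) (v.1, m r p v))).
    apply: le_trans (ler_normD _ _) _; rewrite DB.
    have E1 : `|Db (orbit r p) (v.1, m r p v) - Db (orbit r q) (v.1, m r p v)| <=
        A * `|p - q| * `|v|.
      apply: le_trans (Dlip _ _ _) _.
      have -> : A * `|p - q| * `|v| = (L * (C * `|p - q|)) * ((1 + B) * `|v|).
        by rewrite /A; ring.
      apply: ler_pM => //; [by nonneg|by rewrite ler_wpM2l|].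
      apply: le_trans (norm_pair_le _ _) _; rewrite mulrDl mul1r lerD//.
        exact: norm_fst_le.
      exact: HB.
    have E2 : `|Db (orbit r q) ((v.1, m r p v) - (w.1, m r q w))| <=
        L * `|v - w| + L * `|m r p v - m r q w|.
      apply: le_trans (Dbnd _ _) _; rewrite -mulrDr ler_wpM2l// pairB.
      by apply: le_trans (norm_pair_le _ _) _; rewrite lerD2r (norm_fst_le (v - w)).
    lra.
  have v2 : `|v.2 - w.2| <= `|v - w| := norm_snd_le (v - w).
  rewrite -[leRHS]mulrA ler_wpM2l//.
  have : 0 <= `|p - q| * `|v| by nonneg.
  have : 0 <= A * `|v - w| by nonneg.
  have : 0 <= L * (`|p - q| * `|v|) by nonneg.
  lra.
exists (G * (1 + L + A) + L * (1 + B)).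
  nonneg.
move=> theta theta' p q v w th th'.
rewrite -(subrKA (m theta q w)); apply: le_trans (ler_normD _ _) _.
have H2 : `|m theta q w - m theta' q w| <= L * (1 + B) * `|w| * `|theta - theta'|.
  apply: (norm_incr_lin (fun r => md q w r)) => r rt.
  apply: le_trans (Dbnd _ _) _; rewrite -mulrA ler_wpM2l//.
  apply: le_trans (norm_pair_le _ _) _; rewrite mulrDl mul1r lerD ?norm_fst_le// HB//.
  move: rt; rewrite ge_min le_max => /andP[/orP[] r1 /orP[] r2];
    by move: th th'; rewrite !ler_norml; lra.
apply: le_trans (lerD (H1 _ _ _ _ _ th) H2) _.
set X1 := G * (1 + L + A); set X2 := L * (1 + B).
have X10 : 0 <= X1 by nonneg.
have X20 : 0 <= X2 by nonneg.
have : 0 <= X1 * (`|theta - theta'| * `|w|) by nonneg.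
have : 0 <= X2 * (`|p - q| * `|v| + `|v - w|) by nonneg.
lra.
Qed.

(** The remainder vanishes at theta = 0 and solves the linearised equation up to the Taylor
    remainder of [b] for the displacement [w] between the two orbits. As [|w| <= C |v|], this
    forcing is at most [L C^2 |v|^2]. *)
Lemma flow_taylor tau : 0 <= tau -> exists2 K, 0 <= K &
  forall theta p v, `|theta| <= tau ->
    `|Z (v + p).1 theta (v + p).2 - Z p.1 theta p.2 - m theta p v| <= K * `|v| ^+ 2.
Proof.
move=> tau0; have [G G0 HG] := gronwall d L0 tau0.
have [C C0 HC] := orbit_lipschitz.
exists (G * (L * C ^+ 2)); first nonneg.
move=> theta p v th.
have := HG (fun r => Z (v + p).1 r (v + p).2 - Z p.1 r p.2 - m r p v)
  (fun r => b (v + p).1 (Z (v + p).1 r (v + p).2) - b p.1 (Z p.1 r p.2)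
    - Db (orbit r p) (v.1, m r p v)) 0 theta (L * C ^+ 2 * `|v| ^+ 2).
rewrite !Z0 m0 subr0 => /(_ th) H; rewrite -mulrA; apply: le_trans (H _ _ _) _.
- nonneg.
- by move=> r; apply: is_deriveB; [apply: is_deriveB; exact: Zd|exact: md].
- move=> r _; pose w := orbit r (v + p) - orbit r p.
  have w1 : w = (v.1, Z (v + p).1 r (v + p).2 - Z p.1 r p.2).
    by rewrite /w /orbit pairB /= addrK.
  have E1 : `|b (v + p).1 (Z (v + p).1 r (v + p).2) - b p.1 (Z p.1 r p.2) -
      Db (orbit r p) w| <= L * C ^+ 2 * `|v| ^+ 2.
    have := btay (orbit r p) w; rewrite /w subrK => /le_trans; apply.
    rewrite -mulrA ler_wpM2l// -exprMn ler_pXn2r ?nnegrE ?mulr_ge0//.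
    by apply: le_trans (HC _ _ _) _; rewrite addrK.
  rewrite -(subrKA (Db (orbit r p) w)); apply: le_trans (ler_normD _ _) _.
  rewrite addrC lerD// DB w1 pairB subrr; apply: le_trans (Dbnd _ _) _.
  by rewrite normr_pairE normr0 max_r.
by rewrite /= addrK subrr normr0 add0r.
Qed.

Lemma variational_cancel theta p v :
  m (- theta) (orbit theta p) (v.1, m theta p v) = v.2.
Proof. by rewrite variational_cocycle addNr m0. Qed.

Lemma variational_cancelr theta p v :
  m theta p (v.1, m (- theta) (orbit theta p) v) = v.2.
Proof.
have := variational_cancel (- theta) (orbit theta p) v.
by rewrite opprK -orbit_group addNr orbit0.
Qed.

Lemma flow_diff theta p :
  is_diff p (fun q : P => Z q.1 theta q.2) (m theta p).
Proof.
have [B B0 HB] := variational_bound (normr_ge0 theta).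
have [K K0 HK] := flow_taylor (normr_ge0 theta).
apply: (@is_diff_quadratic _ _ _ _ _ (B + K)) => [v w k|v|v].
- exact: variational_linear.
- by apply: le_trans (HB _ _ _ _) _ => //; rewrite ler_wpM2r// lerDl.
- by apply: le_trans (HK _ _ _ _) _ => //; rewrite ler_wpM2r ?sqr_ge0// lerDr.
Qed.

Lemma flow_jacobian theta t y (v : 'rV[R]_d) :
  v *m jacobian (Z t theta) y = m theta (t, y) (0, v).
Proof.
have : is_diff y (Z t theta) (fun h : 'rV[R]_d => m theta (t, y) (0, h)).
  have Hd := flow_diff theta (t, y).
  exact: (is_diff_comp (is_diff_pair (is_diff_cst t y) (is_diff_id y)) Hd).
by move=> Hd; rewrite /jacobian mul_rV_lin1 /= diff_val.
Qed.

Lemma flow_time_derivative theta t y :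
  derive1 (fun r => Z r theta y) t = m theta (t, y) (1, 0).
Proof.
have Hd : is_diff t (fun r : R => Z r theta y) (fun h => m theta (t, y) (h, 0)).
  have Hd := flow_diff theta (t, y).
  exact: (is_diff_comp (is_diff_pair (is_diff_id t) (is_diff_cst y t)) Hd).
by rewrite derive1E'// diff_val.
Qed.

Lemma flow_curve_derivative theta (I : R -> 'rV[R]_d) t (l : 'rV[R]_d) :
  is_derive t 1 I l ->
  is_derive t 1 (fun r => Z r theta (I r)) (m theta (t, I t) (1, l)).
Proof.
move=> HI.
have HI' : is_diff t I (fun h => h *: l).
  have dI : derivable I t 1 by case: HI.
  apply: DiffDef; first exact/derivable1_diffP.
  by rewrite deriv1E// derive1E derive_val.
have Hd := flow_diff theta (t, I t).
have H : is_diff t (fun r : R => Z r theta (I r))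
    (m theta (t, I t) \o (fun h : R => (h, h *: l) : P)).
  exact: (is_diff_comp (is_diff_pair (is_diff_id t) HI') Hd).
apply: DeriveDef; first exact/derivable1_diffP.
by rewrite deriveE// diff_val /= scale1r.
Qed.

Lemma alpha0E (a : R -> R -> 'rV[R]_d -> 'rV[R]_d) t theta y :
  alpha0 a Z t theta y =
  m (- theta) (t, Z t theta y) (1, a t theta (Z t theta y)).
Proof.
rewrite /alpha0 flow_time_derivative; set z := Z t theta y; set A := a t theta z.
have oE : orbit theta (t, y) = (t, z) by [].
set J := jacobian _ _; pose J' := jacobian (Z t (- theta)) z.
(* [variational_cancel], tested on basis rows, says that the jacobian of the backward flow at [z] is
   a right inverse of [J]; for square matrices this gives invertibility. *)
have JJ' : J *m J' = 1%:M.
  apply/row_matrixP => i; rewrite !rowE !mulmxA mulmx1 flow_jacobian flow_jacobian.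
  by have := variational_cancel theta (t, y) (0, delta_mx 0 i); rewrite oE.
have [Ju _] := mulmx1_unit JJ'.
set v := m (- theta) _ _; suff -> : A - m theta (t, y) (1, 0) = v *m J by rewrite mulmxK.
(* [variational_cancelr] writes [A] as the transport of [(1, v)]. Removing the part carried by
   [(1, 0)], which is the time derivative of Z, leaves the transport of [(0, v)], that is
   [v *m J]. *)
rewrite flow_jacobian; have := variational_cancelr theta (t, y) (1, A).
rewrite oE -/v /= => <-.
have -> : (1, v) = (0, v) + 1 *: (1, 0) :> P.
  rewrite scale1r; transitivity ((0 + 1, v + 0) : P) => [|//].
  by rewrite add0r addr0.
by rewrite variational_linear scale1r addrK.
Qed.

End Flow.

(** * Uniform bounds on [alpha0] and the filtered equation *)

Section AveragedField.
Variables (R : realType) (d : nat).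
Notation P := (R * 'rV[R]_d)%type.
Variables (b : R -> 'rV[R]_d -> 'rV[R]_d) (Z : R -> R -> 'rV[R]_d -> 'rV[R]_d).
Variables (L : R) (Db : P -> P -> 'rV[R]_d).
Hypothesis L0 : 0 <= L.
Hypothesis bT : taylor_field L (fun p : P => b p.1 p.2) Db.
Hypothesis Zf : is_flow b Z.
Hypothesis Zp : forall t z, periodic (fun theta => Z t theta z) (2 * pi).
Variables (a : R -> R -> 'rV[R]_d -> 'rV[R]_d) (La : R).
Hypothesis La0 : 0 <= La.
Hypothesis alip : forall p q : R * R * 'rV[R]_d,
  `|a p.1.1 p.1.2 p.2 - a q.1.1 q.1.2 q.2| <= La * `|p - q|.
Hypothesis abnd : forall p : R * R * 'rV[R]_d, `|a p.1.1 p.1.2 p.2| <= La.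
Hypothesis aper : forall t x, periodic (fun theta => a t theta x) (2 * pi).
Implicit Types (t theta tau : R) (y z : 'rV[R]_d).

Lemma alpha0_periodic t theta y :
  alpha0 a Z t (theta + 2 * pi) y = alpha0 a Z t theta y.
Proof.
have E := flow_periodic Zp theta.
have E1 t' : Z t' (theta + 2 * pi) = Z t' theta by have := congr1 (fun f => f t') E.
rewrite /alpha0 E1 (aper t (Z t theta y)).
by under eq_fun do rewrite E1.
Qed.

Lemma alpha0_local_lipschitz tau : 0 <= tau -> exists2 K, 0 <= K &
  forall theta theta' t t' y y', `|theta| <= tau -> `|theta'| <= tau ->
    `|alpha0 a Z t theta y - alpha0 a Z t' theta' y'| <=
      K * (`|theta - theta'| + (`|t - t'| + `|y - y'|)).
Proof.
move=> tau0; have [m mv] := variational_exists L0 bT Zf.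
have [Kv Kv0 HKv] := variational_lipschitz L0 bT Zf Zp mv tau0.
have [C C0 HC] := orbit_lipschitz L0 bT Zf Zp.
pose W := 1 + La; have W0 : 0 <= W by nonneg.
(* The three terms come from the three arguments of [m]: the angle ([W] bounds the direction
   [(1, a)]), the base point (an orbit moves by at most [C (dt + dy) + L dth]), and the direction
   (through the Lipschitz constant of [a]). *)
exists (Kv * (W + (C + L) * W + La * (1 + C + L))); first by nonneg.
move=> theta theta' t t' y y' th th'.
rewrite !(alpha0E L0 bT Zf Zp mv).
set z := Z t theta y; set z' := Z t' theta' y'.
set w := (1, a t theta z); set w' := (1, a t' theta' z').
set dt := `|t - t'|; set dth := `|theta - theta'|; set dy := `|y - y'|.
have Ho : `|(t, z) - (t', z')| <= C * (dt + dy) + L * dth.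
  have -> : (t, z) - (t', z') = orbit Z theta (t, y) - orbit Z theta' (t', y') by [].
  rewrite -(subrKA (orbit Z theta (t', y'))); apply: le_trans (ler_normD _ _) _.
  apply: lerD; last exact: (orbit_time_lipschitz bT Zf).
  apply: le_trans (HC _ _ _) _; rewrite ler_wpM2l//.
  exact: (norm_pair_le (t - t') (y - y')).
have Hw q : `|(1, a q.1.1 q.1.2 q.2) : P| <= W.
  by apply: le_trans (norm_pair_le _ _) _; rewrite normr1 lerD2l abnd.
have Hww : `|w - w'| <= La * (dt + dth + (C * (dt + dy) + L * dth)).
  rewrite -[w - w']/(1 - 1, a t theta z - a t' theta' z') subrr normr_pairE normr0 max_r//.
  apply: le_trans (alip ((t, theta), z) ((t', theta'), z')) _; rewrite ler_wpM2l//.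
  apply: le_trans (norm_pair_le ((t, theta) - (t', theta')) (z - z')) _.
  apply: lerD; first exact: (norm_pair_le (t - t') (theta - theta')).
  by apply: le_trans Ho; exact: (norm_snd_le (t - t', z - z')).
apply: le_trans (HKv _ _ _ _ _ _ _ _) _; rewrite ?normrN//.
rewrite -opprD normrN -/dth -[leRHS]mulrA ler_wpM2l//.
have dt0 : 0 <= dt := normr_ge0 _; have dy0 : 0 <= dy := normr_ge0 _.
have dth0 : 0 <= dth := normr_ge0 _.
have H1 : dth * `|w'| <= dth * W by rewrite ler_wpM2l// (Hw (t', theta', z')).
have H2 : `|(t, z) - (t', z')| * `|w| <= (C * (dt + dy) + L * dth) * W.
  by apply: ler_pM => //; exact: (Hw (t, theta, z)).
apply: le_trans (lerD (lerD H1 H2) Hww) _.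
have : 0 <= W * (dt + dy) by nonneg.
have : 0 <= C * W * dth by nonneg.
have : 0 <= L * W * (dt + dy) by nonneg.
have : 0 <= La * dy by nonneg.
have : 0 <= La * C * dth by nonneg.
have : 0 <= La * L * (dt + dy) by nonneg.
lra.
Qed.

Lemma alpha0_bounds : exists2 K, 0 <= K &
  (forall t theta y, `|alpha0 a Z t theta y| <= K) /\
  (forall t t' theta y y', `|alpha0 a Z t theta y - alpha0 a Z t' theta y'| <=
     K * (`|t - t'| + `|y - y'|)).
Proof.
have tp0 := two_pi_gt0 R.
have [m mv] := variational_exists L0 bT Zf.
have [K K0 HK] := alpha0_local_lipschitz (ltW tp0).
have [B B0 HB] := variational_bound L0 bT mv (ltW tp0).
have red theta : exists2 th, `|th| <= 2 * pi & forall t y,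
    alpha0 a Z t theta y = alpha0 a Z t th y.
  have per : forall th, (fun t y => alpha0 a Z t (th + 2 * pi) y) =
      (fun t y => alpha0 a Z t th y).
    by move=> th; apply/funext => t; apply/funext => y; exact: alpha0_periodic.
  have [th /andP[th0 th1] E] := periodic_reduce
    (f := fun th t y => alpha0 a Z t th y) tp0 per theta.
  exists th; first by rewrite ger0_norm.
  by move=> t y; have := congr1 (fun f => f t y) E.
exists (K + B * (1 + La)); first by nonneg.
split=> [t theta y|t t' theta y y']; have [th th1 E] := red theta; rewrite !E.
  rewrite (alpha0E L0 bT Zf Zp mv); apply: le_trans (HB _ _ _ _) _; first by rewrite normrN.
  apply: ler_wpDl => //; rewrite ler_wpM2l//.
  apply: le_trans (norm_pair_le _ _) _; rewrite normr1 lerD2l.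
  exact: (abnd (t, th, _)).
apply: le_trans (HK _ _ _ _ _ _ _ _) _ => //; rewrite subrr normr0 add0r.
by rewrite ler_wpM2r ?addr_ge0// lerDl; nonneg.
Qed.

Lemma alpha0_continuous t y : continuous (fun theta => alpha0 a Z t theta y).
Proof.
apply: local_lipschitz_continuous => tau.
have [K K0 HK] := alpha0_local_lipschitz (normr_ge0 tau).
exists K => th th' h h'.
apply: le_trans (HK th th' t t y y _ _) _; rewrite ?(le_trans _ (ler_norm tau))//.
by rewrite !subrr !normr0 !addr0.
Qed.

(* Writing the flow at time - (r - s) / eps as the flow at the frozen time
   - (t - s) / eps after a short time - (r - t) / eps, the short part cancels the
   singular term of the field. *)
Lemma filtered_derivative (s eps : R) (X : R -> 'rV[R]_d) : 0 < eps ->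
  (forall t, is_derive t 1 X (osc_field a b s eps t (X t))) ->
  forall t, is_derive t 1 (fun r => Z r (- ((r - s) / eps)) (X r))
    (alpha0 a Z t ((t - s) / eps) (Z t (- ((t - s) / eps)) (X t))).
Proof.
move=> e0 HX t; have [m mv] := variational_exists L0 bT Zf.
have bbnd r x : `|b r x| <= L by case: bT => _ _ _ _ [_ H]; exact: (H (r, x)).
have blip (p q : P) : `|b p.1 p.2 - b q.1 q.2| <= L * `|p - q|.
  by case: bT => _ _ _ _ [H _]; exact: H.
have Z0 r x : Z r 0 x = x by have [] := Zf r x.
have Zd r x (th : R) : is_derive th 1 (fun th => Z r th x) (b r (Z r th x)).
  by have [] := Zf r x.
pose th0 := (t - s) / eps; pose phi r := (t - r) / eps.
pose I r := Z r (phi r) (X r).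
have phit : phi t = 0 by rewrite /phi subrr mul0r.
have It : I t = X t by rewrite /I phit Z0.
have YE : (fun r => Z r (- ((r - s) / eps)) (X r)) = (fun r => Z r (- th0) (I r)).
  apply/funext => r; rewrite /I -(flow_group L0 bT Zf); congr (Z r _ _).
  by rewrite /phi /th0; ring.
pose MX := La + eps^-1 * L.
have ie0 : 0 <= eps^-1 by rewrite invr_ge0 ltW.
have MX0 : 0 <= MX by nonneg.
have XL r : `|X r - X t| <= MX * `|r - t|.
  apply: (norm_incr_lin HX) => q _; rewrite /osc_field.
  apply: le_trans (ler_normD _ _) _; rewrite lerD//; first exact: (abnd (q, _, _)).
  by rewrite normrZ ger0_norm// ler_wpM2l.
set b0 := b t (X t).
(* [flow_diff] holds the angle fixed, so the moving angle [phi r] is treated by hand: [I r - X r] is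
   the displacement under the flow during the short time [phi r], equal to [phi r *: b0] up to a
   quadratic error. *)
have dIX : is_derive t 1 (fun r => I r - X r) (- eps^-1 *: b0).
  (* During this displacement [b] is evaluated within [(1 + L / eps + MX) |h|] of [(t, X t)]: the
     change of t, the motion of the flow and the motion of [X]. The last [1 / eps] comes from
     [|phi r|]. *)
  apply: (@is_derive_quadratic _ _ _ _ _ (L * (1 + L * eps^-1 + MX) * eps^-1)) => h.
  rewrite It subrr subr0 /I; set r := h + t.
  have phir : phi r = - (h * eps^-1) by rewrite /phi /r; ring.
  have -> : h *: (- eps^-1 *: b0) = phi r *: b0 by rewrite scalerA phir mulrN.
  pose u th := Z r th (X r) - th *: b0.
  have du (th : R) : is_derive th 1 u (b r (Z r th (X r)) - b0).
    apply: is_deriveB.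
    have -> : (fun th : R => th *: b0) = (fun th : R => (1 * th + 0) *: b0).
      by apply/funext => q; rewrite mul1r addr0.
    apply/is_derive_rowP => i.
    have -> : (fun q : R => ((1 * q + 0) *: b0) 0 i) = (fun q => b0 0 i * q + 0).
      by apply/funext => q; rewrite !mxE mul1r !addr0 mulrC.
    exact: is_derive_affine.
  have -> : Z r (phi r) (X r) - X r - phi r *: b0 = u (phi r) - u 0.
    by rewrite /u Z0 scale0r subr0 addrAC.
  have hn : `|h| ^+ 2 = h ^+ 2 by rewrite real_normK ?num_real.
  apply: (@le_trans _ _ (L * ((1 + L * eps^-1 + MX) * `|h|) * `|phi r - 0|)).
    apply: (norm_incr_lin du) => th thr.
    apply: le_trans (blip (r, Z r th (X r)) (t, X t)) _; rewrite ler_wpM2l//.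
    apply: le_trans (norm_pair_le (r - t) _) _.
    have rt : r - t = h by rewrite /r addrK.
    have H1 : `|Z r th (X r) - X r| <= L * eps^-1 * `|h|.
      rewrite -[X in _ - X](Z0 r) -mulrA; apply: le_trans (flow_time_lipschitz bT Zf _ _ _ _) _.
      rewrite ler_wpM2l// subr0.
      have : `|phi r| = eps^-1 * `|h| by rewrite phir normrN normrM mulrC (ger0_norm ie0).
      move=> <-; move: thr; rewrite ge_min le_max => /andP[/orP[] r1 /orP[] r2];
        have := ler_norm (phi r); have := lerNnormlW (lexx `|phi r|);
        have := normr_ge0 (phi r); rewrite ler_norml; lra.
    have H2 := XL r; rewrite rt in H2.
    have H3 : `|Z r th (X r) - X t| <= `|Z r th (X r) - X r| + `|X r - X t|.
      by rewrite -(subrKA (X r)) ler_normD.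
    rewrite rt; lra.
  rewrite subr0 phir normrN normrM (ger0_norm ie0) -hn.
  rewrite le_eqVlt; apply/orP; left; apply/eqP; ring.
have dI : is_derive t 1 I (a t th0 (X t)).
  have -> : I = (fun r => I r - X r) + X.
    by apply/funext => r; rewrite !fctE subrK.
  have -> : a t th0 (X t) = - eps^-1 *: b0 + osc_field a b s eps t (X t).
    by rewrite /osc_field addrCA scaleNr addNr addr0.
  exact: is_deriveD.
have := flow_curve_derivative L0 bT Zf Zp mv (- th0) dI.
rewrite YE It (alpha0E L0 bT Zf Zp mv) -/th0.
suff -> : Z t th0 (Z t (- th0) (X t)) = X t by [].
by rewrite -(flow_group L0 bT Zf) addrN Z0.
Qed.

End AveragedField.

(** * Averaging *)

Section AveragingEstimate.
Variables (R : realType) (d : nat).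
Variables (alpha : R -> R -> 'rV[R]_d -> 'rV[R]_d) (K : R).
Hypothesis K0 : 0 <= K.
Hypothesis abnd : forall t theta y, `|alpha t theta y| <= K.
Hypothesis alip : forall t t' theta y y',
  `|alpha t theta y - alpha t' theta y'| <= K * (`|t - t'| + `|y - y'|).
Hypothesis acont : forall t y, continuous (fun theta => alpha t theta y).
Hypothesis aper : forall t theta y, alpha t (theta + 2 * pi) y = alpha t theta y.

(** For [alpha := alpha0 a Z] this is convertible to [abar0 a Z], which is how the estimates of this
    section reach the theorem. *)
Definition time_average (t : R) (y : 'rV[R]_d) : 'rV[R]_d :=
  \row_i ((2 * pi)^-1 *
    Rintegral (@lebesgue_measure R) `[0, 2 * pi] (fun theta => alpha t theta y 0 i)).

Let tp0 : 0 < 2 * pi :> R. Proof. exact: two_pi_gt0. Qed.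

(** This trades the Lebesgue integral for an increment of a primitive, to which [norm_incr_lin]
    applies. *)
Lemma time_averageE (A : R -> 'rV[R]_d) t y :
  (forall theta : R, is_derive theta 1 A (alpha t theta y)) ->
  A (2 * pi) - A 0 = (2 * pi) *: time_average t y.
Proof.
move=> HA; apply/rowP => i; rewrite !mxE mulrA divff ?gt_eqF// mul1r.
have HAi (theta : R) := is_derive_coord i (HA theta).
have cA := is_derive_continuousT HAi.
rewrite /Rintegral (@continuous_FTC2 _ _ (fun theta => A theta 0 i)) //.
- apply: continuous_subspaceT => th.
  by have := cvg_comp _ _ (acont (t := t) (y := y) (x := th)) (@coord_continuous R 1 d 0 i _).
- split.
  + by move=> th _; have [] := HAi th.
  + by apply: cvg_at_right_filter; exact: cA.
  + by apply: cvg_at_left_filter; exact: cA.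
- by move=> th _; rewrite derive1E; have [_ ->] := HAi th.
Qed.

Lemma time_average_bounded t y : `|time_average t y| <= K.
Proof.
have [A _ HA] := antiderivative 0 0 (acont (t := t) (y := y)).
rewrite -(ler_pM2l tp0) -[X in X * `|_|](gtr0_norm tp0) -normrZ -(time_averageE HA).
rewrite [leRHS]mulrC; apply: le_trans (norm_incr_lin HA (fun r _ => abnd t r y)) _.
by rewrite subr0 (gtr0_norm tp0).
Qed.

Lemma time_average_lipschitz t t' y y' :
  `|time_average t y - time_average t' y'| <= K * (`|t - t'| + `|y - y'|).
Proof.
have [A _ HA] := antiderivative 0 0 (acont (t := t) (y := y)).
have [B _ HB] := antiderivative 0 0 (acont (t := t') (y := y')).
rewrite -(ler_pM2l tp0) -[X in X * `|_|](gtr0_norm tp0) -normrZ scalerBr.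
rewrite -(time_averageE HA) -(time_averageE HB) [leRHS]mulrC.
have -> : A (2 * pi) - A 0 - (B (2 * pi) - B 0) =
    (A (2 * pi) - B (2 * pi)) - (A 0 - B 0) by apply/rowP => i; rewrite !mxE; ring.
have HAB (r : R) := is_deriveB (HA r) (HB r).
apply: le_trans (norm_incr_lin HAB (fun r _ => alip t t' r y y')) _.
by rewrite subr0 (gtr0_norm tp0).
Qed.

Lemma antiderivative_shift (A : R -> 'rV[R]_d) t y theta :
  (forall theta : R, is_derive theta 1 A (alpha t theta y)) ->
  A (theta + 2 * pi) - A theta = (2 * pi) *: time_average t y.
Proof.
move=> HA; rewrite -(time_averageE HA).
pose u th := A (th + 2 * pi) - A th - (A (2 * pi) - A 0).
apply/eqP; rewrite -subr_eq0 -/(u theta); apply/eqP.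
apply: (@gronwall_eq0 _ _ 0 u (fun=> 0) 0) => //.
- move=> th.
  have H : is_derive th 1 (fun r => A (r + 2 * pi)) (alpha t th y).
    by rewrite -[X in is_derive _ _ _ X]aper; exact: is_derive_shiftr.
  have := is_deriveB (is_deriveB H (HA th)) (is_derive_cst (A (2 * pi) - A 0) th 1).
  by rewrite subrr subr0.
- by move=> th; rewrite normr0 mul0r.
- by rewrite /u add0r subrr.
Qed.

(* The comparison is made with the sliding mean U of Y over one period of the
   fast variable: U' t is the increment quotient of Y, which is the averaged
   field up to O(eps), and U is O(eps)-close to Y. *)
Lemma averaging_estimate (s T : R) : 0 <= T -> exists2 C, 0 <= C &
  forall (eps : R) (Y Y0 : R -> 'rV[R]_d), 0 < eps ->
    (forall t : R, is_derive t 1 Y (alpha t ((t - s) / eps) (Y t))) ->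
    (forall t : R, is_derive t 1 Y0 (time_average t (Y0 t))) -> Y s = Y0 s ->
    forall t, s <= t <= s + T -> `|Y t - Y0 t| <= C * eps.
Proof.
move=> T0; have [G G0 HG] := gronwall d K0 T0.
(* With [dl = 2 pi eps]: the gap between U and Y is at most [K dl], once at time s and once at time
   t. The forcing [(K + 2 K^2) dl] is [K (1 + K) dl] from averaging plus [K^2 dl] from replacing Y
   by U in the averaged field. *)
exists (2 * pi * (G * (K + (K + 2 * K ^+ 2)) + K)).
  by apply: mulr_ge0; [exact: ltW|nonneg].
move=> eps Y Y0 e0 HY HY0 Ys t /andP[st tT].
pose dl := 2 * pi * eps; have dl0 : 0 < dl by rewrite mulr_gt0.
have YL r q : `|Y r - Y q| <= K * `|r - q|.
  by apply: (norm_incr_lin HY) => *; exact: abnd.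
have near_dl r q : Num.min r (r + dl) <= q <= Num.max r (r + dl) -> `|q - r| <= dl.
  have rdl : r <= r + dl by rewrite lerDl ltW.
  rewrite min_l// max_r// => /andP[rq qr].
  by rewrite ger0_norm ?subr_ge0// lerBlDl.
have incr_dl r : `|r + dl - r| = dl by rewrite addrC addKr gtr0_norm.
have cY := is_derive_continuousT HY.
have [A _ HA] := antiderivative s 0 cY.
pose U r := dl^-1 *: (A (r + dl) - A r).
pose dU r := dl^-1 *: (Y (r + dl) - Y r).
have HU (r : R) : is_derive r 1 U (dU r).
  have H : is_derive r 1 (fun q => A (q + dl)) (Y (r + dl)) by exact: is_derive_shiftr.
  have HB := is_deriveB H (HA r); exact: is_deriveZ.
have scaled (v : 'rV[R]_d) c : `|v| <= c * dl -> `|dl^-1 *: v| <= c.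
  move=> vc; rewrite normrZ gtr0_norm ?invr_gt0// mulrC ler_pdivrMr//.
have UY r : `|U r - Y r| <= K * dl.
  have -> : U r - Y r = dl^-1 *: ((A (r + dl) - (r + dl) *: Y r) - (A r - r *: Y r)).
    rewrite -[Y r in LHS]scale1r -[1](mulVf (lt0r_neq0 dl0)) -scalerA -scalerBr.
    congr (_ *: _); rewrite scalerDl; apply/rowP => i; rewrite !mxE; ring.
  apply: scaled; rewrite -[X in _ <= _ * X](incr_dl r).
  pose u q := A q - q *: Y r.
  have Hu (q : R) : is_derive q 1 u (Y q - Y r).
    apply: is_deriveB; apply/is_derive_rowP => i.
    have -> : (fun q : R => (q *: Y r) 0 i) = (fun q => Y r 0 i * q + 0).
      by apply/funext => x; rewrite !mxE addr0 mulrC.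
    exact: is_derive_affine.
  apply: (norm_incr_lin Hu) => q /near_dl qr.
  by apply: le_trans (YL _ _) _; rewrite ler_wpM2l.
have Uavg r : `|dU r - time_average r (Y r)| <= K * (1 + K) * dl.
  have [B _ HB] := antiderivative 0 0 (acont (t := r) (y := Y r)).
  (* [H] is a primitive, in slow time, of the field frozen at [(r, Y r)]. As [dl / eps] is one
     period, its increment over the window is exactly [dl] times the average; freezing costs
     [K (dl + K dl)]. *)
  pose H q := eps *: B (eps^-1 * q + - (s / eps)).
  have HE q : eps^-1 * q + - (s / eps) = (q - s) / eps by ring.
  have HH (q : R) : is_derive q 1 H (alpha r ((q - s) / eps) (Y r)).
    rewrite -[X in is_derive _ _ _ X](scalerKV (lt0r_neq0 e0)).
    have HBq : is_derive q 1 (fun x => B (eps^-1 * x + - (s / eps)))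
        (eps^-1 *: alpha r ((q - s) / eps) (Y r)).
      by apply: is_derive_comp_affine; rewrite HE; exact: HB.
    exact: is_deriveZ.
  have Hdl : H (r + dl) - H r = dl *: time_average r (Y r).
    rewrite /H -scalerBr !HE (_ : (r + dl - s) / eps = (r - s) / eps + 2 * pi).
      by rewrite (antiderivative_shift _ HB) scalerA /dl mulrC.
    by rewrite /dl; field; rewrite gt_eqF.
  have -> : dU r - time_average r (Y r) =
      dl^-1 *: ((Y (r + dl) - H (r + dl)) - (Y r - H r)).
    rewrite -[time_average _ _]scale1r -[1](mulVf (lt0r_neq0 dl0)) -scalerA -scalerBr.
    by rewrite -Hdl; congr (_ *: _); apply/rowP => i; rewrite !mxE; ring.
  apply: scaled; rewrite -[X in _ <= _ * X](incr_dl r).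
  have HYH (q : R) := is_deriveB (HY q) (HH q).
  apply: (norm_incr_lin HYH) => q /near_dl qr.
  apply: le_trans (alip _ _ _ _ _) _.
  have -> : K * (1 + K) * dl = K * (dl + K * dl) by ring.
  rewrite ler_wpM2l// lerD//.
  by apply: le_trans (YL _ _) _; rewrite ler_wpM2l.
have HUY (r : R) := is_deriveB (HU r) (HY0 r).
have := HG _ _ s t ((K + 2 * K ^+ 2) * dl) _ _ HUY.
rewrite ger0_norm ?subr_ge0// lerBlDl => /(_ tT) H.
have {}H : `|U t - Y0 t| <= G * (`|U s - Y0 s| + (K + 2 * K ^+ 2) * dl).
  apply: H => [|r _]; first by (have dl1 := ltW dl0; nonneg).
  rewrite !fctE -(subrKA (time_average r (Y r))).
  apply: le_trans (ler_normD _ _) _; apply: le_trans (lerD (Uavg r) (time_average_lipschitz _ _ _ _)) _.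
  rewrite subrr normr0 add0r.
  have : `|Y r - Y0 r| <= K * dl + `|U r - Y0 r|.
    by rewrite -(subrKA (U r)) (le_trans (ler_normD _ _))// lerD// distrC.
  move=> /(ler_wpM2l K0); rewrite expr2; lra.
have Us : `|U s - Y0 s| <= K * dl by rewrite -Ys.
have {}H : `|U t - Y0 t| <= G * (K * dl + (K + 2 * K ^+ 2) * dl).
  by apply: (le_trans H); rewrite ler_wpM2l// lerD2r.
rewrite -(subrKA (U t)) (le_trans (ler_normD _ _))// distrC.
apply: le_trans (lerD (UY t) H) _; rewrite /dl le_eqVlt; apply/orP; left; apply/eqP.
ring.
Qed.

End AveragingEstimate.

(** * Solutions on a segment and solutions on the line *)

Section InitialValueProblems.
Variables (R : realType) (d : nat).
Implicit Types (F : R -> 'rV[R]_d -> 'rV[R]_d) (X : R -> 'rV[R]_d).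

Lemma is_derive_ivp_sol F (u v : R) (x : 'rV[R]_d) X : X u = x ->
  (forall t : R, is_derive t 1 X (F t (X t))) -> ivp_sol F u v x X.
Proof.
move=> Xu HX; split => // t _; have [dX <-] := HX t.
have := dX; rewrite /derivable => /cvgrPdist_le H; apply/cvgrPdist_le => e e0.
have [r r0 Hr] := H e e0; exists r => // q /= tq qt _.
have := Hr (q - t); rewrite /= [_ *: 1]mulr1 subrK; apply.
  by rewrite sub0r opprB.
by rewrite subr_eq0.
Qed.

Lemma ivp_sol_derive F (u v : R) (x : 'rV[R]_d) X t : ivp_sol F u v x X ->
  t \in `]u, v[ -> is_derive t 1 X (F t (X t)).
Proof.
move=> [_ HX]; rewrite in_itv/= => /andP[ut tv].
have tuv : t \in `[u, v] by rewrite in_itv/= !ltW.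
have Hlim : h^-1 *: ((X \o shift t) (h *: 1) - X t) @[h --> 0^'] --> F t (X t).
  apply/cvgrPdist_le => e e0.
  have /cvgrPdist_le /(_ e e0) [r r0 Hr] := HX t tuv.
  exists (Num.min r (Num.min (t - u) (v - t))).
    by rewrite /= !lt_min r0 !subr_gt0 ut.
  move=> h; rewrite /= sub0r normrN !lt_min => /and3P[hr hu hv] h0.
  have := Hr (h + t); rewrite /= [_ *: 1]mulr1 addrK; apply.
  - by rewrite opprD addrCA subrr addr0 normrN.
  - by rewrite -subr_eq0 addrK.
  - by move: hu hv; rewrite in_itv/= !ltr_norml => /andP[? ?] /andP[? ?]; lra.
by apply: DeriveDef; [exact: cvgP Hlim|exact: cvg_lim Hlim].
Qed.

Lemma ivp_sol_continuous F (u v : R) (x : 'rV[R]_d) X : ivp_sol F u v x X ->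
  {within `[u, v], continuous X}.
Proof.
move=> [_ HX]; apply/subspace_continuousP => t tuv; apply/cvgrPdist_le => e e0.
have /cvgrPdist_le /(_ 1 ltr01) [r r0 Hr] := HX t tuv.
pose c := `|F t (X t)| + 1; have c0 : 0 < c by rewrite ltr_wpDl.
exists (Num.min r (e / c)); first by rewrite /= lt_min r0 divr_gt0.
move=> q /=; rewrite lt_min => /andP[qr qe] quv.
have [->|qt] := eqVneq q t; first by rewrite subrr normr0 ltW.
have Hq : `|(q - t)^-1 *: (X q - X t)| <= c.
  rewrite -[X in `|X|](subKr (F t (X t))) (le_trans (ler_normB _ _))// lerD2l.
  exact: Hr.
move: Hq; rewrite normrZ normfV mulrC ler_pdivrMr ?normr_gt0 ?subr_eq0// distrC => Hq.
apply: le_trans Hq _; rewrite mulrC -ler_pdivlMr// distrC; exact: ltW.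
Qed.

(** A solution on a segment has a two-sided derivative at interior points only and is continuous up
    to the ends, which is the setting of [gronwall_within]. *)
Lemma ivp_sol_unique F (L u v : R) (x : 'rV[R]_d) X X' : 0 <= L ->
  (forall t x y, `|F t x - F t y| <= L * `|x - y|) ->
  ivp_sol F u v x X -> ivp_sol F u v x X' -> {in `[u, v], X' =1 X}.
Proof.
move=> L0 HL HX HX' t; rewrite in_itv/= => /andP[ut tv].
have tu0 : 0 <= t - u by rewrite subr_ge0.
have [G _ HG] := gronwall_within d L0 tu0.
have sub Y : ivp_sol F u v x Y -> {within `[u, t], continuous Y}.
  move=> /ivp_sol_continuous; apply: continuous_subspaceW.
  by move=> r /=; rewrite !in_itv/= => /andP[-> rt]; rewrite (le_trans rt).
have subo r : r \in `]u, t[ -> r \in `]u, v[.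
  by rewrite !in_itv/= => /andP[-> rt]; rewrite (lt_le_trans rt).
have := HG (fun r => X' r - X r) (fun r => F r (X' r) - F r (X r)) u t 0 ut (lexx _) (lexx _).
rewrite (proj1 HX) (proj1 HX') subrr normr0 addr0 mulr0 => H.
apply/eqP; rewrite -subr_eq0 -normr_le0; apply: H.
- have /subspace_continuousP c1 := sub _ HX; have /subspace_continuousP c2 := sub _ HX'.
  by apply/subspace_continuousP => r ru; apply: cvgB; [exact: c2|exact: c1].
- by move=> r /subo ruv; exact: (is_deriveB (ivp_sol_derive HX' ruv) (ivp_sol_derive HX ruv)).
- by move=> r _; rewrite addr0.
Qed.

(** One curve, differentiable on the whole line, represents the solution on every segment starting
    at s; the averaging argument is run on this curve. *)
Lemma global_solution F (L M s : R) (x : 'rV[R]_d) : 0 <= L ->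
  (forall x, continuous (F^~ x)) ->
  (forall t x y, `|F t x - F t y| <= L * `|x - y|) ->
  (forall t, `|F t x| <= M) ->
  exists X, [/\ X s = x, forall t : R, is_derive t 1 X (F t (X t)),
    forall v, ivp_sol F s v x X &
    forall v X', ivp_sol F s v x X' -> {in `[s, v], X' =1 X}].
Proof.
move=> L0 cF HL HM; have [X Xs HX] := picard s cF HL HM.
have HXv v : ivp_sol F s v x X by exact: is_derive_ivp_sol.
by exists X; split=> // v X' HX'; exact: (ivp_sol_unique L0 HL (HXv v) HX').
Qed.

End InitialValueProblems.

Section Convergence.
Variables (R : realType) (d : nat).

(** The supremum is squeezed between 0 and [C eps]. A point of [S] provides the lower bound, the
    extended supremum of the empty set being minus infinity. *)
Lemma ereal_sup_cvg0 (T : Type) (S : set T) (f : R -> T -> R) (C : R) :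
  S !=set0 -> (forall eps x, 0 < eps -> S x -> 0 <= f eps x <= C * eps) ->
  ereal_sup [set (f eps x)%:E | x in S] @[eps --> 0^'+] --> 0%:E.
Proof.
move=> [x0 Sx0] Hf.
have HC : (C * eps)%:E @[eps --> 0^'+] --> 0%:E.
  apply: cvg_EFin; first by near=> e.
  have : (fun eps : R => C * eps + 0) eps @[eps --> 0] --> C * 0 + 0.
    exact: is_derive_continuous (is_derive_affine C 0 0).
  rewrite mulr0 addr0 => /cvg_at_right_filter.
  by under eq_fun do rewrite addr0.
apply: (@squeeze_cvge _ _ _ _ (cst 0%:E) _ (fun eps => (C * eps)%:E)) => //; last first.
  exact: cvg_cst.
near=> eps; have e0 : 0 < eps by near: eps; exact: nbhs_right_gt.
apply/andP; split.
  apply: (@le_trans _ _ (f eps x0)%:E); first by rewrite lee_fin; case/andP: (Hf _ _ e0 Sx0).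
  by apply: ereal_sup_ubound; exists x0.
apply: ge_ereal_sup => _ [y Sy <-]; rewrite lee_fin.
by case/andP: (Hf _ _ e0 Sy).
Unshelve. all: by end_near. Qed.

(** These constants blow up as eps tends to 0; they serve only existence and uniqueness of the
    oscillating solution for each fixed eps. *)
Lemma osc_field_lipschitz (a : R -> R -> 'rV[R]_d -> 'rV[R]_d)
    (b : R -> 'rV[R]_d -> 'rV[R]_d) (s eps La Lb : R) : 0 < eps -> 0 <= La ->
  (forall p q : R * R * 'rV[R]_d,
    `|a p.1.1 p.1.2 p.2 - a q.1.1 q.1.2 q.2| <= La * `|p - q|) ->
  (forall p q : R * 'rV[R]_d, `|b p.1 p.2 - b q.1 q.2| <= Lb * `|p - q|) ->
  forall t t' x y, `|osc_field a b s eps t x - osc_field a b s eps t' y| <=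
    (La * (1 + eps^-1) + eps^-1 * Lb) * `|t - t'| + (La + eps^-1 * Lb) * `|x - y|.
Proof.
move=> e0 La0 alip blip t t' x y.
have ie0 : 0 <= eps^-1 by rewrite invr_ge0 ltW.
have Lb0 : 0 <= Lb.
  have := le_trans (normr_ge0 _) (blip (1, 0) 0).
  by rewrite subr0 normr_pairE normr1 normr0 max_l// mulr1.
have HA : `|a t ((t - s) / eps) x - a t' ((t' - s) / eps) y| <=
    La * (`|t - t'| + eps^-1 * `|t - t'| + `|x - y|).
  apply: le_trans (alip ((t, (t - s) / eps), x) ((t', (t' - s) / eps), y)) _.
  rewrite ler_wpM2l//.
  apply: le_trans (norm_pair_le ((t, (t - s) / eps) - (t', (t' - s) / eps)) (x - y)) _.
  rewrite lerD2r; apply: le_trans (norm_pair_le (t - t') _) _; rewrite lerD2l.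
  by rewrite -mulrBl opprB addrA subrK normrM mulrC (ger0_norm ie0).
have HB : `|b t x - b t' y| <= Lb * (`|t - t'| + `|x - y|).
  apply: le_trans (blip (t, x) (t', y)) _.
  by rewrite ler_wpM2l// (norm_pair_le (t - t') (x - y)).
rewrite /osc_field opprD addrACA -scalerBr.
apply: le_trans (ler_normD _ _) _; rewrite normrZ (ger0_norm ie0).
apply: le_trans (lerD HA (ler_wpM2l ie0 HB)) _.
rewrite le_eqVlt; apply/orP; left; apply/eqP; ring.
Qed.

End Convergence.

Theorem theorem1p1 (R : realType) (d : nat) (d_ge1 : (1 <= d)%N)
    (a : R -> R -> 'rV[R]_d -> 'rV[R]_d) (b : R -> 'rV[R]_d -> 'rV[R]_d)
    (Z : R -> R -> 'rV[R]_d -> 'rV[R]_d)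
    (a_C1b : forall i : 'I_d,
      Cb 1 (fun p : R * R * 'rV[R]_d => a p.1.1 p.1.2 p.2 0 i))
    (a_per : forall t x, periodic (fun theta => a t theta x) (2 * pi))
    (b_C2b : forall i : 'I_d, Cb 2 (fun p : R * 'rV[R]_d => b p.1 p.2 0 i))
    (Z_flow : is_flow b Z)
    (Z_per : forall t z, periodic (fun theta => Z t theta z) (2 * pi))
    (x : 'rV[R]_d) (s T : R) (T_gt0 : 0 < T) :
  [/\ forall eps : R, 0 < eps ->
        ivp_well_posed (osc_field a b s eps) s (s + T) x,
      ivp_well_posed (abar0 a Z) s (s + T) x
    & forall (X : R -> R -> 'rV[R]_d) (Y0 : R -> 'rV[R]_d),
        (forall eps : R, 0 < eps ->
           ivp_sol (osc_field a b s eps) s (s + T) x (X eps)) ->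
        ivp_sol (abar0 a Z) s (s + T) x Y0 ->
        ereal_sup [set (enorm (X eps t - Z t ((t - s) / eps) (Y0 t)))%:E
                  | t in `[s, s + T]] @[eps --> 0^'+] --> 0%:E].
Proof.
have span2 := spanning_pair (spanning_real R) (spanning_row R d).
have span3 := spanning_pair (spanning_pair (spanning_real R) (spanning_real R))
  (spanning_row R d).
have [La [La0 alip abnd]] := Cb1_row span3 a_C1b.
have [L L0 [Db bT]] := Cb2_row span2 b_C2b.
have [blip bbnd] : (forall p q : R * 'rV[R]_d,
    `|b p.1 p.2 - b q.1 q.2| <= L * `|p - q|) /\
    forall p : R * 'rV[R]_d, `|b p.1 p.2| <= L by case: bT.
have [K K0 [albnd allip]] := alpha0_bounds L0 bT Z_flow Z_per La0 alip abnd a_per.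
have alcont := alpha0_continuous L0 bT Z_flow Z_per La0 alip abnd.
have alper t theta y := alpha0_periodic Z_per a_per t theta y.
have osc eps : 0 < eps -> exists X, [/\ X s = x,
    forall t : R, is_derive t 1 X (osc_field a b s eps t (X t)),
    forall v, ivp_sol (osc_field a b s eps) s v x X &
    forall v X', ivp_sol (osc_field a b s eps) s v x X' -> {in `[s, v], X' =1 X}].
  move=> e0; have ie0 : 0 <= eps^-1 by rewrite invr_ge0 ltW.
  have olip := osc_field_lipschitz s e0 La0 alip blip.
  apply: (@global_solution _ _ _ (La + eps^-1 * L) (La + eps^-1 * L)).
  - by nonneg.
  - move=> y; apply: lipschitz_continuous => t t'.
    by apply: le_trans (olip t t' y y) _; rewrite (subrr y) normr0 mulr0 addr0.
  - move=> t y z; apply: le_trans (olip t t y z) _.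
    by rewrite (subrr t) normr0 mulr0 add0r.
  - move=> t; apply: le_trans (ler_normD _ _) _; rewrite lerD//.
      exact: (abnd (t, _, x)).
    by rewrite normrZ ger0_norm// ler_wpM2l// (bbnd (t, x)).
have tblip t t' y y' : `|abar0 a Z t y - abar0 a Z t' y'| <=
    K * (`|t - t'| + `|y - y'|) := time_average_lipschitz allip alcont t t' y y'.
have [Yg [Ygs HYg Ygsol Ygu]] : exists Y, [/\ Y s = x,
    forall t : R, is_derive t 1 Y (abar0 a Z t (Y t)),
    forall v, ivp_sol (abar0 a Z) s v x Y &
    forall v Y', ivp_sol (abar0 a Z) s v x Y' -> {in `[s, v], Y' =1 Y}].
  apply: (@global_solution _ _ _ K K) => //.
  - move=> y; apply: (@lipschitz_continuous _ _ _ _ K) => t t'.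
    by apply: le_trans (tblip t t' y y) _; rewrite (subrr y) normr0 addr0.
  - move=> t y z; apply: le_trans (tblip t t y z) _.
    by rewrite (subrr t) normr0 add0r.
  - by move=> t; exact: (time_average_bounded albnd alcont).
split.
- by move=> eps /osc [X [_ _ HX HXu]]; exists X => // X'; exact: HXu.
- by exists Yg => // Y'; exact: Ygu.
move=> X Y0 HX HY0.
have [C C0 HC] := averaging_estimate K0 albnd allip alcont alper s (ltW T_gt0).
have [CZ CZ0 HCZ] := flow_lipschitz L0 bT Z_flow Z_per.
(* The convergence has rate eps: [C] is the averaging error, [CZ] the Lipschitz constant of the flow
   uniform in the angle, and sqrt d the passage from max norm to Euclidean norm. *)
apply: (@ereal_sup_cvg0 _ _ _ _ (Num.sqrt d%:R * (CZ * C))).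
  by exists s; rewrite /= in_itv/= lexx lerDl ltW.
move=> eps t e0 tsT; apply/andP; split; first exact: sqrtr_ge0.
have [Xg [Xgs HXg _ Xgu]] := osc eps e0.
have -> : X eps t = Xg t by apply: Xgu tsT; exact: HX.
have -> : Y0 t = Yg t by apply: Ygu tsT.
have HY := filtered_derivative L0 bT Z_flow Z_per La0 abnd e0 HXg.
have Z0 r z : Z r 0 z = z by have [] := Z_flow r z.
have Ys : (fun r => Z r (- ((r - s) / eps)) (Xg r)) s = Yg s.
  by rewrite subrr mul0r oppr0 Z0 Xgs Ygs.
have tsT' : s <= t <= s + T by move: tsT; rewrite /= in_itv.
have := HC eps _ Yg e0 HY HYg Ys t tsT'.
set y := Z t _ _ => Hy.
(* Undoing the filter presents both terms as images under the same map [Z t ((t - s) / eps)], so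
   their distance is controlled by that of [y] and [Yg t]. *)
have -> : Xg t = Z t ((t - s) / eps) y.
  by rewrite /y -(flow_group L0 bT Z_flow) addrN Z0.
apply: le_trans (enorm_le _) _; rewrite -mulrA ler_wpM2l ?sqrtr_ge0//.
apply: le_trans (HCZ _ (t, y) (t, Yg t)) _; rewrite -mulrA ler_wpM2l//.
by apply: le_trans Hy; rewrite -[_ - _]/(t - t, y - Yg t) subrr normr_pairE normr0 max_r.
Qed.
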